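(* Consider non-unital qubit channels $\Lambda$ with rank-three Choi state for which the final state $\rho^f=(\mathbf I\otimes\Lambda)(|\Phi_1\rangle\langle\Phi_1|)$, obtained by sending one half of the Bell state $|\Phi_1\rangle=\frac{1}{\sqrt2}(|00\rangle+|11\rangle)$ through $\Lambda$, is useful for universal quantum teleportation (UQT), where without loss of generality $\rho^f$ is taken in its canonical representation $$\rho^f=\tfrac14\Bigl[\mathbf I_4+\mathbf I_2\otimes\boldsymbol s\cdot\boldsymbol\sigma-t\sum_{i=1}^3\sigma_i\otimes\sigma_i\Bigr],\qquad \boldsymbol s=(1-t)(\sin\theta\cos\phi,\ \sin\theta\sin\phi,\ \cos\theta).$$ The most general such channels are represented by the class of channels with the following three orthogonal Kraus operators (written in the basis $\{|0\rangle,|1\rangle\}$), where $\frac13<t<1$, $\theta\in[0,\pi]$, $\phi\in[0,2\pi]$ and $R=\sqrt{(1-t)^2+4t^2}$: $$K_0=y_0\begin{pmatrix}\dfrac{i(1-t)\sin\theta\,e^{-i\phi}}{(1-t)\cos\theta-2t-R}&\dfrac{i\left((1-t)^2(1+\cos^2\theta)+2(1-t)\cos\theta\,R\right)}{(1-t)^2\sin^2\theta+4t(1-t)\cos\theta}\\[2mm]-i&\dfrac{i(1-t)\sin\theta\,e^{i\phi}}{-(1-t)\cos\theta+2t+R}\end{pmatrix},$$ $$K_1=y_1\begin{pmatrix}\dfrac{-i(1+\cos\theta)}{\sin\theta\,e^{i\phi}}&-i\\[2mm]-i&\dfrac{-i(1-\cos\theta)}{\sin\theta\,e^{-i\phi}}\end{pmatrix},$$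 $$K_2=y_2\begin{pmatrix}\dfrac{i(1-t)\sin\theta\,e^{-i\phi}}{(1-t)\cos\theta-2t+R}&\dfrac{i\left((1-t)^2(1+\cos^2\theta)-2(1-t)\cos\theta\,R\right)}{(1-t)^2\sin^2\theta+4t(1-t)\cos\theta}\\[2mm]-i&\dfrac{-i(1-t)\sin\theta\,e^{i\phi}}{(1-t)\cos\theta-2t+R}\end{pmatrix},$$ with $$y_0=\frac{2t-(1-t)\cos\theta+R}{2\sqrt2}\sqrt{\frac{1+t+R}{(1-t)^2+2t(2t+R)}},\qquad y_1=\frac{\sin\theta\sqrt{1-t}}{2},$$ $$y_2=\frac{(1-t)\cos\theta-2t+R}{2\sqrt2}\sqrt{\frac{1+t-R}{(1-t)^2+2t(2t-R)}}.$$ These Kraus operators always satisfy $\sum_{i=0}^2K_i^\dagger K_i=\mathbf I_2$ and $\sum_{i=0}^2K_iK_i^\dagger\neq\mathbf I_2$, and the associated Choi states are non-negative, so they represent completely positive trace-preserving maps associated with non-unital channels.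
   Context: A qubit channel is a completely positive trace-preserving linear map $\Lambda(\chi)=\sum_iK_i\chi K_i^\dagger$ on $2\times2$ complex matrices; it is unital if $\Lambda(\mathbf I_2)=\mathbf I_2$ and non-unital otherwise. Kraus operators are not unique: sets of Kraus operators related by a unitary mixing $\tilde K_i=\sum_jW_{ij}K_j$ define the same channel. Kraus operators are called orthogonal if $\mathrm{Tr}(K_i^\dagger K_j)=0$ for $i\neq j$. The Choi state of $\Lambda$ is $(\mathbf I\otimes\Lambda)(|\Phi_1\rangle\langle\Phi_1|)$. Here $\boldsymbol\sigma=(\sigma_1,\sigma_2,\sigma_3)$ are the Pauli matrices. Useful for UQT. For a two-qubit density matrix $\rho$ let $T_\rho$ be the real $3\times3$ matrix with entries $T_{ij}=\mathrm{Tr}(\rho\,\sigma_i\otimes\sigma_j)$. By local unitaries $\rho$ can be brought to a canonical form $\rho_C$ whose correlation matrix is diagonal with entries $\lambda_k|t_{kk}|$, $\lambda_k\in\{-1,+1\}$, $k=1,2,3$; if $\det T_\rho\le0$ one can take $\lambda_k=-1$ for all $k$ with $|t_{kk}|\neq0$. The maximal average fidelity $F_\rho$ is the teleportation fidelity averaged over uniformly distributed pure qubit inputs in the standard teleportation protocol, maximized over local unitaries (the maximum is attained by $\rho_C$). The fidelity deviation $\Delta_\rho$ is the standard deviation of the fidelity over the inputs when $\rho_C$ is used. The state $\rho$ is useful for UQT if $F_\rho>\frac23$ and $\Delta_\rho=0$. States with $F_\rho>\frac23$ satisfy $\det T_\rho<0$, and for states with $\det T_\rho<0$ one has $F_\rho=\frac12\bigl(1+\frac13\sum_i|t_{ii}|\bigr)$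 and $\Delta_\rho=\frac{1}{3\sqrt{10}}\sqrt{\sum_{i<j}(|t_{ii}|-|t_{jj}|)^2}$, so that such a state is useful for UQT exactly when $|t_{11}|=|t_{22}|=|t_{33}|>\frac13$. For the canonical final state displayed in the claim, rank three corresponds to $|\boldsymbol s|=1-t$.
   Formalization: At angles where the displayed Kraus operators are 0/0 (θ=0 or π for K_1; (1−t)cosθ=2t−R for K_0 and K_2), the entries are read as limits in θ; these limits are proved to exist, and everywhere else the displayed formulas are used as they stand. *)

(* Defs.v *)
From HB Require Import structures.
From mathcomp Require Import all_boot all_order all_algebra.
From mathcomp Require Import complex mxtens spectral sesquilinear.
From mathcomp Require Import all_classical all_reals all_analysis.
Import Order.TTheory GRing.Theory Num.Theory.
Import numFieldNormedType.Exports.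
Set Implicit Arguments.
Unset Strict Implicit.
Unset Printing Implicit Defensive.

(* Matrices over [R[i]] represent operators in the computational basis; a
   two-qubit operator is indexed by ['I_(2 * 2)] through [mxtens_index], so
   that [A *t B] is the Kronecker product. The adjoint is [A ^t*]. *)

Local Open Scope classical_set_scope.
Local Open Scope sesquilinear_scope.
Local Open Scope ring_scope.
Local Open Scope complex_scope.

Section Operators.
Variable R : realType.
Local Notation C := R[i].

Definition mx2 (a b c d : C) : 'M[C]_2 :=
  \matrix_(i < 2, j < 2)
    if i == ord0 then (if j == ord0 then a else b)
    else (if j == ord0 then c else d).

(* [pauli 0] is the identity, [pauli 1], [pauli 2], [pauli 3] are
   sigma_1, sigma_2, sigma_3. *)
Definition pauli (k : nat) : 'M[C]_2 :=
  match k with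
  | 0 => 1%:M
  | 1 => mx2 0 1 1 0
  | 2 => mx2 0 (- 'i%C) 'i%C 0
  | 3 => mx2 1 0 0 (- 1)
  | _ => 0
  end.

(* The order of [R[i]] makes [0 <= z] mean "[z] is real and nonnegative", so
   this entails that [A] is Hermitian. *)
Definition psd n (A : 'M[C]_n) : Prop :=
  forall v : 'cV[C]_n, 0 <= (v ^t* *m A *m v) ord0 ord0.

Definition block n (X : 'M[C]_(n * 2)) (a b : 'I_n) : 'M[C]_2 :=
  \matrix_(i < 2, j < 2) X (mxtens_index (a, i)) (mxtens_index (b, j)).

(* The map [id_n (x) L] on [n]-by-[n] matrices of 2-by-2 blocks. *)
Definition idtens n (L : 'M[C]_2 -> 'M[C]_2) (X : 'M[C]_(n * 2)) :
    'M[C]_(n * 2) :=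
  \sum_(a < n) \sum_(b < n) (delta_mx a b *t L (block X a b)).

Definition completely_positive (L : 'M[C]_2 -> 'M[C]_2) : Prop :=
  forall n (X : 'M[C]_(n * 2)), psd X -> psd (idtens L X).

Definition trace_preserving (L : 'M[C]_2 -> 'M[C]_2) : Prop :=
  forall X, \tr (L X) = \tr X.

Definition qubit_channel (L : 'M[C]_2 -> 'M[C]_2) : Prop :=
  [/\ linear L, completely_positive L & trace_preserving L].

Definition unital (L : 'M[C]_2 -> 'M[C]_2) : Prop := L 1%:M = 1%:M.

Definition kraus_map m (K : 'I_m -> 'M[C]_2) (X : 'M[C]_2) : 'M[C]_2 :=
  \sum_(i < m) K i *m X *m (K i) ^t*.

Definition ket (k : 'I_2) : 'cV[C]_2 := delta_mx k ord0.

(* |Phi_1> = (|00> + |11>) / sqrt 2 *)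
Definition bell_phi : 'cV[C]_(2 * 2) :=
  ((Num.sqrt 2)^-1)%:C *:
    ((ket 0 *t ket 0 : 'cV[C]_(2 * 2)) + (ket 1 *t ket 1 : 'cV[C]_(2 * 2))).

Definition choi (L : 'M[C]_2 -> 'M[C]_2) : 'M[C]_(2 * 2) :=
  idtens L (bell_phi *m bell_phi ^t*).

Definition local_unitary (U V : 'M[C]_2) (rho : 'M[C]_(2 * 2)) :
    'M[C]_(2 * 2) :=
  (U *t V) *m rho *m (U *t V) ^t*.

(* Since (U (x) 1)|Phi_1> = (1 (x) U^T)|Phi_1>, the Choi state of
   [rotate U V L] is [local_unitary U V (choi L)]. *)
Definition rotate (U V : 'M[C]_2) (L : 'M[C]_2 -> 'M[C]_2) (X : 'M[C]_2) :
    'M[C]_2 :=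
  V *m L (U^T *m X *m (U^T) ^t*) *m V ^t*.

End Operators.

Section Teleportation.
Variable R : realType.
Local Notation C := R[i].

(* |Psi^-> = (|01> - |10>) / sqrt 2 *)
Definition singlet : 'cV[C]_(2 * 2) :=
  ((Num.sqrt 2)^-1)%:C *:
    ((ket R 0 *t ket R 1 : 'cV[C]_(2 * 2)) - (ket R 1 *t ket R 0 : 'cV[C]_(2 * 2))).

(* The Bell basis of the sender's measurement, up to phases
   Psi^-, Phi^-, Phi^+, Psi^+ for k = 0, 1, 2, 3. *)
Definition bell (k : nat) : 'cV[C]_(2 * 2) := (pauli R k *t 1%:M) *m singlet.

(* Unnormalised state of the receiver after outcome [k], when the first qubit
   of psi (x) rho is the input and rho is shared; its trace is the probability
   of the outcome. *)
Definition receiver (rho : 'M[C]_(2 * 2)) (psi : 'cV[C]_2) (k : nat) :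
    'M[C]_2 :=
  ((bell k) ^t* *t (1%:M : 'M[C]_2) : 'M[C]_(1 * 2, 2 * 2 * 2))
    *m ((psi *m psi ^t*) *t rho : 'M[C]_(2 * 2 * 2))
    *m (bell k *t (1%:M : 'M[C]_2) : 'M[C]_(2 * 2 * 2, 1 * 2)).

(* After outcome [k] the receiver applies [pauli k]. This assignment of the
   corrections is the one for which the singlet (correlation matrix -1)
   teleports perfectly, in agreement with the signs of the canonical form. *)
Definition teleport (rho : 'M[C]_(2 * 2)) (psi : 'cV[C]_2) : 'M[C]_2 :=
  \sum_(k < 4) pauli R k *m receiver rho psi k *m (pauli R k) ^t*.

Definition fidelity (rho : 'M[C]_(2 * 2)) (psi : 'cV[C]_2) : R :=
  complex.Re ((psi ^t* *m teleport rho psi *m psi) ord0 ord0).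

Definition bloch_ket (a b : R) : 'cV[C]_2 :=
  (cos (a / 2))%:C *: ket R 0 + ((cos b +i* sin b) * (sin (a / 2))%:C) *: ket R 1.

(* Mean over uniformly distributed pure states, i.e. with respect to the
   normalised area sin a da db / (4 pi) of the Bloch sphere. *)
Definition bloch_mean (g : 'cV[C]_2 -> R) : R :=
  (4 * pi)^-1 *
  \int[lebesgue_measure]_(a in `[0%R, pi])
    (\int[lebesgue_measure]_(b in `[0%R, 2 * pi]) (g (bloch_ket a b) * sin a)).

Definition average_fidelity (rho : 'M[C]_(2 * 2)) : R :=
  bloch_mean (fidelity rho).

Definition fidelity_sd (rho : 'M[C]_(2 * 2)) : R :=
  Num.sqrt
    (bloch_mean (fun psi => (fidelity rho psi - average_fidelity rho) ^+ 2)).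

Definition max_average_fidelity (rho : 'M[C]_(2 * 2)) : R :=
  sup [set f | exists U V : 'M[C]_2,
    [/\ U \is unitarymx, V \is unitarymx &
        f = average_fidelity (local_unitary U V rho)]].

Definition correlation (rho : 'M[C]_(2 * 2)) : 'M[R]_3 :=
  \matrix_(i < 3, j < 3)
    complex.Re (\tr (rho *m (pauli R i.+1 *t pauli R j.+1))).

(* Diagonal correlation matrix with the signs for which the average fidelity
   attains its maximum over local unitaries: all entries nonpositive when the
   determinant is, otherwise exactly one positive entry, of least modulus. *)
Definition is_canonical (rho : 'M[C]_(2 * 2)) : Prop :=
  let T := correlation rho in
  [/\ is_diag_mx T,
      \det T <= 0 -> forall k, T k k <= 0 &
      0 < \det T -> exists k, 0 < T k k /\
        (forall j, j != k -> T j j < 0 /\ T k k <= `|T j j|)].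

Definition canonical_form (rho rhoC : 'M[C]_(2 * 2)) : Prop :=
  (exists U V : 'M[C]_2, [/\ U \is unitarymx, V \is unitarymx &
     rhoC = local_unitary U V rho]) /\ is_canonical rhoC.

(* The value is the same for all canonical forms of [rho], which differ by the
   order of the diagonal correlations. *)
Definition fidelity_deviation (rho : 'M[C]_(2 * 2)) (delta : R) : Prop :=
  exists rhoC, canonical_form rho rhoC /\ delta = fidelity_sd rhoC.

Definition useful_UQT (rho : 'M[C]_(2 * 2)) : Prop :=
  2 / 3 < max_average_fidelity rho /\ fidelity_deviation rho 0.

End Teleportation.

Section KrausClass.
Variable R : realType.
Local Notation C := R[i].

Definition svec (t th ph : R) (k : nat) : R :=
  match k with
  | 1 => (1 - t) * (sin th * cos ph)
  | 2 => (1 - t) * (sin th * sin ph)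
  | 3 => (1 - t) * cos th
  | _ => 0
  end.

Definition final_state (t th ph : R) : 'M[C]_(2 * 2) :=
  4^-1 *: ((1%:M : 'M[C]_(2 * 2))
    + (1%:M : 'M[C]_2) *t (\sum_(k < 3) (svec t th ph k.+1)%:C *: pauli R k.+1)
    - t%:C *: \sum_(k < 3) (pauli R k.+1 *t pauli R k.+1)).

Definition Rad (t : R) : R := Num.sqrt ((1 - t) ^+ 2 + 4 * t ^+ 2).

Definition y0 (t th : R) : R :=
  (2 * t - (1 - t) * cos th + Rad t) / (2 * Num.sqrt 2)
  * Num.sqrt ((1 + t + Rad t) / ((1 - t) ^+ 2 + 2 * t * (2 * t + Rad t))).

Definition y1 (t th : R) : R := sin th * Num.sqrt (1 - t) / 2.

Definition y2 (t th : R) : R :=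
  ((1 - t) * cos th - 2 * t + Rad t) / (2 * Num.sqrt 2)
  * Num.sqrt ((1 + t - Rad t) / ((1 - t) ^+ 2 + 2 * t * (2 * t - Rad t))).

Definition expi (x : R) : C := cos x +i* sin x.

(* Denominator of the upper right entries of K_0 and K_2. *)
Definition Den (t th : R) : R :=
  (1 - t) ^+ 2 * sin th ^+ 2 + 4 * t * (1 - t) * cos th.

Definition K0 (t th ph : R) : 'M[C]_2 :=
  (y0 t th)%:C *: mx2
    ('i%C * ((1 - t) * sin th)%:C * expi (- ph)
       / ((1 - t) * cos th - 2 * t - Rad t)%:C)
    ('i%C * ((1 - t) ^+ 2 * (1 + cos th ^+ 2)
           + 2 * (1 - t) * cos th * Rad t)%:C / (Den t th)%:C)
    (- 'i%C)
    ('i%C * ((1 - t) * sin th)%:C * expi ph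
       / (- ((1 - t) * cos th) + 2 * t + Rad t)%:C).

Definition K1 (t th ph : R) : 'M[C]_2 :=
  (y1 t th)%:C *: mx2
    (- 'i%C * (1 + cos th)%:C / ((sin th)%:C * expi ph))
    (- 'i%C)
    (- 'i%C)
    (- 'i%C * (1 - cos th)%:C / ((sin th)%:C * expi (- ph))).

Definition K2 (t th ph : R) : 'M[C]_2 :=
  (y2 t th)%:C *: mx2
    ('i%C * ((1 - t) * sin th)%:C * expi (- ph)
       / ((1 - t) * cos th - 2 * t + Rad t)%:C)
    ('i%C * ((1 - t) ^+ 2 * (1 + cos th ^+ 2)
           - 2 * (1 - t) * cos th * Rad t)%:C / (Den t th)%:C)
    (- 'i%C)
    (- 'i%C * ((1 - t) * sin th)%:C * expi ph
       / ((1 - t) * cos th - 2 * t + Rad t)%:C).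

Definition kraus_formula (t th ph : R) (i : 'I_3) : 'M[C]_2 :=
  match val i with
  | 0 => K0 t th ph
  | 1 => K1 t th ph
  | _ => K2 t th ph
  end.

(* No denominator depending on the angles vanishes. *)
Definition kraus_regular (t th : R) : bool :=
  [&& sin th != 0, Den t th != 0,
      (1 - t) * cos th - 2 * t - Rad t != 0 &
      (1 - t) * cos th - 2 * t + Rad t != 0].

(* The displayed matrices contain expressions of the form 0/0 when
   [sin th = 0] (the poles, for K_1) and at the single angle with
   [(1 - t) * cos th = 2 * t - Rad t] (for K_0 and K_2). There they are read
   as limits in [th]. *)
Definition kraus (t th ph : R) (i : 'I_3) : 'M[C]_2 :=
  if kraus_regular t th then kraus_formula t th ph i else
  \matrix_(j < 2, k < 2)
    (lim (complex.Re (kraus_formula t x ph i j k) @[x --> th^'])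
     +i* lim (complex.Im (kraus_formula t x ph i j k) @[x --> th^'])).

Definition parameter_range (t th ph : R) : Prop :=
  [/\ 1 / 3 < t < 1, 0 <= th <= pi & 0 <= ph <= 2 * pi].

End KrausClass.

(* Main.v *)
Require Import Defs.
From HB Require Import structures.
From mathcomp Require Import all_boot all_order all_algebra.
From mathcomp Require Import complex mxtens spectral sesquilinear.
From mathcomp Require Import all_classical all_reals all_analysis.
From mathcomp Require Import ring lra.
Import Order.TTheory GRing.Theory Num.Theory.
Import numFieldNormedType.Exports.
Local Open Scope classical_set_scope.
Local Open Scope sesquilinear_scope.
Local Open Scope ring_scope.
Local Open Scope complex_scope.

(* Since (W (x) 1)|Phi_1> determines W, a linear map L is determined by its Choi
   state, and teleportation through rho only sees the diagonal of the
   correlation matrix T: the fidelity at Bloch vector n is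
   (tr rho - sum_k T_kk n_k^2) / 2.  Its mean and variance over the sphere are
   explicit, so zero deviation of a canonical form forces T = - t 1, and since
   local unitaries multiply T by rotations, max F > 2/3 forces t > 1/3.
   For a channel with T = - t 1, trace preservation leaves only the Bloch
   vector s of the output of the identity free; positivity on m (x) m, with m
   opposite to s, gives |s| <= 1 - t, and a null vector of the Choi state then
   gives |s| = 1 - t.  Conversely, after removing the 0/0 singularities, K_0
   and K_2 are combinations of eps = i sigma_2 and (n.sigma) eps, K_1 has rank
   one, and the Choi state of the class is computed entrywise. *)

Set Implicit Arguments.
Unset Strict Implicit.
Unset Printing Implicit Defensive.

(** The Kraus operators are, up to scaling, the eigenvectors of the Choi state read as matrices.
    Take four times the state, with |s| = 1 - t and n the direction of s. The product vector along
    n, n has eigenvalue 2(1 - t), the one along -n, -n has eigenvalue 0, and on the span of the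
    singlet and the spin-0 triplet state along n the matrix has rows (1 + 3t, 1 - t) and (1 - t, 1 -
    t). Its eigenvalues are 1 + t + R and 1 + t - R, with eigenvectors (R + 2t, 1 - t) and (R - 2t,
    -(1 - t)). This is the origin of R, of the numerators under the roots of [y0] and [y2], and of
    rank three. The relation R^2 - 4 t^2 = (1 - t)^2 drives most identities below. The obstacle in
    the classification is that usefulness speaks of some canonical form, which may differ from the
    state at hand. States are therefore compared through T T^T = t^2 1, which local unitaries
    preserve. This leaves the signs of a canonical T open; positivity together with t > 1/3 decides
    them. *)

Lemma sum_one_mx (F : comNzRingType) (V : lmodType F) n (a b : 'I_n) (f : 'I_n -> 'I_n -> V) :
  \sum_c \sum_d ((1%:M : 'M[F]_n) a c * (1%:M : 'M[F]_n) d b) *: f c d = f a b.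
Proof.
rewrite (bigD1 a) //= (bigD1 b) //= !mxE !eqxx mulr1 scale1r !big1 ?addr0 //.
  by move=> c ca; rewrite big1 // => d _; rewrite mxE eq_sym (negPf ca) mul0r scale0r.
by move=> d db; rewrite !mxE (negPf db) mulr0 scale0r.
Qed.

(** * Operators on a tensor product as matrices of 2-by-2 blocks *)

Section BlockCalculus.
Variable R : realType.
Local Notation C := R[i].

Lemma conjcD (x y : C) : conjc (x + y) = conjc x + conjc y.
Proof. exact: rmorphD. Qed.

Lemma conjcM (x y : C) : conjc (x * y) = conjc x * conjc y.
Proof. exact: rmorphM. Qed.

Lemma conjcN (x : C) : conjc (- x) = - conjc x.
Proof. exact: rmorphN. Qed.

Lemma conjc_i : conjc 'i%C = - 'i%C :> C.
Proof. by simpc. Qed.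

Lemma adjE m n (A : 'M[C]_(m, n)) i j : (A ^t*) i j = conjc (A j i).
Proof. by rewrite !mxE. Qed.

Lemma adj_mul m n p (A : 'M[C]_(m, n)) (B : 'M[C]_(n, p)) :
  (A *m B) ^t* = B ^t* *m A ^t*.
Proof. by rewrite trmx_mul map_mxM. Qed.

Lemma adj_tens m n p q (A : 'M[C]_(m, n)) (B : 'M[C]_(p, q)) :
  (A *t B) ^t* = A ^t* *t B ^t*.
Proof. by apply/matrixP => i j; rewrite !mxE rmorphM. Qed.

Lemma adjK m n (A : 'M[C]_(m, n)) : (A ^t*) ^t* = A.
Proof. by apply/matrixP => i j; rewrite !adjE conjcK. Qed.

Lemma ord2P (P : 'I_2 -> Prop) : P 0 -> P 1 -> forall i, P i.
Proof.
move=> P0 P1 [[|[|//]] lti].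
- by have -> : Ordinal lti = 0 by exact: val_inj.
- by have -> : Ordinal lti = 1 by exact: val_inj.
Qed.

Lemma mx2E (a b c d : C) :
  ((mx2 a b c d 0 0 = a) * (mx2 a b c d 0 1 = b) *
   (mx2 a b c d 1 0 = c) * (mx2 a b c d 1 1 = d))%type.
Proof. by rewrite !mxE. Qed.

Lemma eq_mx2 (A B : 'M[C]_2) : A 0 0 = B 0 0 -> A 0 1 = B 0 1 ->
  A 1 0 = B 1 0 -> A 1 1 = B 1 1 -> A = B.
Proof. by move=> *; apply/matrixP; apply: ord2P; apply: ord2P. Qed.

Lemma sum2 (V : nmodType) (F : 'I_2 -> V) : \sum_(i < 2) F i = F 0 + F 1.
Proof.
by rewrite !big_ord_recl big_ord0 addr0; congr (_ + F _); apply: val_inj.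
Qed.

Lemma tr2 (A : 'M[C]_2) : \tr A = A 0 0 + A 1 1.
Proof. by rewrite /mxtrace sum2. Qed.

Lemma sum_mxtens (V : nmodType) m n (F : 'I_(m * n) -> V) :
  \sum_k F k = \sum_i \sum_j F (mxtens_index (i, j)).
Proof.
rewrite pair_bigA /= (reindex (@mxtens_index m n)) /=; first by apply: eq_bigr => -[].
by exists (@mxtens_unindex m n) => i _; rewrite ?mxtens_indexK ?mxtens_unindexK.
Qed.

Lemma blockE n (X : 'M[C]_(n * 2)) a b i j :
  block X a b i j = X (mxtens_index (a, i)) (mxtens_index (b, j)).
Proof. by rewrite mxE. Qed.

Lemma eq_block n (X Y : 'M[C]_(n * 2)) :
  (forall a b, block X a b = block Y a b) -> X = Y.
Proof.
move=> XY; apply/matrixP => i j; rewrite -(mxtens_unindexK i) -(mxtens_unindexK j).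
case: (mxtens_unindex i) (mxtens_unindex j) => [a k] [b l].
by have := congr1 (fun Z : 'M[C]_2 => Z k l) (XY a b); rewrite !blockE.
Qed.

Lemma block_sum n I (r : seq I) (F : I -> 'M[C]_(n * 2)) a b :
  block (\sum_(i <- r) F i) a b = \sum_(i <- r) block (F i) a b.
Proof.
by apply/matrixP => i j; rewrite blockE !summxE; apply: eq_bigr => k _; rewrite blockE.
Qed.

Lemma blockD n (X Y : 'M[C]_(n * 2)) a b :
  block (X + Y) a b = block X a b + block Y a b.
Proof. by apply/matrixP => i j; rewrite !mxE. Qed.

Lemma blockZ n c (X : 'M[C]_(n * 2)) a b :
  block (c *: X) a b = c *: block X a b.
Proof. by apply/matrixP => i j; rewrite !mxE. Qed.

Lemma block_tens n (A : 'M[C]_n) (B : 'M[C]_2) a b :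
  block (A *t B) a b = A a b *: B.
Proof. by apply/matrixP => i j; rewrite blockE tensmxE mxE. Qed.

(** Each matrix unit selects a single term of the double sum, so [idtens] acts block by block.
    Identities about [idtens] and [choi] are checked on blocks through this lemma. *)
Lemma block_idtens n L (X : 'M[C]_(n * 2)) a b :
  block (idtens L X) a b = L (block X a b).
Proof.
rewrite /idtens block_sum (bigD1 a) //= block_sum (bigD1 b) //= block_tens.
rewrite mxE !eqxx scale1r !big1 ?addr0 // => c ca; last first.
  by rewrite block_tens mxE eqxx /= eq_sym (negPf ca) scale0r.
rewrite block_sum big1 // => d _; rewrite block_tens mxE.
by rewrite (eq_sym a) (negPf ca) scale0r.
Qed.

Lemma blocks_sum n (X : 'M[C]_(n * 2)) :
  X = \sum_(a < n) \sum_(b < n) (delta_mx a b *t block X a b).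
Proof. by apply: eq_block => a b; rewrite -[LHS](block_idtens id). Qed.

Lemma mul_delta_mx_entry m n (A : 'M[C]_(m, n)) (D : 'M[C]_(n, m)) a b c d :
  (A *m delta_mx c d *m D) a b = A a c * D d b.
Proof.
rewrite -(mul_delta_mx (0 : 'I_1)) mulmxA -colE -mulmxA -rowE mxE.
by rewrite big_ord1 !mxE.
Qed.

Lemma block_mulmx m n (A : 'M[C]_(m, n)) (B : 'M[C]_2)
    (X : 'M[C]_(n * 2)) (D : 'M[C]_(n, m)) (E : 'M[C]_2) a b :
  block ((A *t B) *m X *m (D *t E)) a b =
  \sum_c \sum_d (A a c * D d b) *: (B *m block X c d *m E).
Proof.
rewrite {1}(blocks_sum X) mulmx_sumr mulmx_suml block_sum; apply: eq_bigr => c _.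
rewrite mulmx_sumr mulmx_suml block_sum; apply: eq_bigr => d _.
by rewrite !tensmx_mul block_tens mul_delta_mx_entry.
Qed.

Lemma tr_mul_tens n (X : 'M[C]_(n * 2)) (A : 'M[C]_n) (B : 'M[C]_2) :
  \tr (X *m (A *t B)) = \sum_a \sum_b A b a * \tr (block X a b *m B).
Proof.
rewrite {1}(blocks_sum X) mulmx_suml linear_sum; apply: eq_bigr => a _ /=.
rewrite mulmx_suml linear_sum; apply: eq_bigr => b _ /=.
rewrite tensmx_mul /mxtrace sum_mxtens.
under eq_bigr => i _ do under eq_bigr => j _ do rewrite tensmxE.
under eq_bigr => i _ do rewrite -mulr_sumr.
rewrite -mulr_suml; congr (_ * _).
rewrite (bigD1 a) //= big1 ?addr0 => [|i ia].
  rewrite -[delta_mx a b *m A]mul1mx mulmxA mul_delta_mx_entry mxE.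
  by rewrite eqxx mul1r.
by rewrite -[delta_mx a b *m A]mul1mx mulmxA mul_delta_mx_entry mxE (negPf ia) mul0r.
Qed.

Lemma psd_congr m n (B : 'M[C]_(m, n)) (A : 'M[C]_n) :
  psd A -> psd (B *m A *m B ^t*).
Proof.
move=> psdA v; have := psdA (B ^t* *m v).
by rewrite adj_mul adjK !mulmxA.
Qed.

Lemma psd_sum n I (r : seq I) (F : I -> 'M[C]_n) :
  (forall i, psd (F i)) -> psd (\sum_(i <- r) F i).
Proof.
move=> psdF v; rewrite mulmx_sumr mulmx_suml summxE.
by apply: sumr_ge0 => i _; exact: psdF.
Qed.

Lemma psd_rank1 n (v : 'cV[C]_n) : psd (v *m v ^t*).
Proof.
move=> w; rewrite mulmxA -mulmxA mxE big_ord1.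
have -> : (v ^t* *m w) 0 0 = conjc ((w ^t* *m v) 0 0).
  by rewrite -adjE adj_mul adjK.
exact: mulcJ_ge0.
Qed.

Lemma quadE n (A : 'M[C]_n) (v : 'cV[C]_n) :
  (v ^t* *m A *m v) 0 0 = \sum_k \sum_l conjc (v k 0) * (v l 0) * A k l.
Proof.
rewrite mxE exchange_big /=; apply: eq_bigr => l _; rewrite mxE mulr_suml.
by apply: eq_bigr => k _; rewrite adjE mulrAC.
Qed.

(* Polarisation: v^* A v is real for v = e_i + e_j and for v = e_i + i e_j. *)
Lemma psd_adj n (A : 'M[C]_n) : psd A -> A ^t* = A.
Proof.
move=> psdA; apply/matrixP => i j; rewrite adjE.
have pick (F : 'I_n -> C) (z : C) :
    \sum_k ((k == i)%:R + z * (k == j)%:R) * F k = F i + z * F j.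
  under eq_bigr do rewrite mulrDl -mulrA.
  rewrite big_split -mulr_sumr /=; congr (_ + _ * _).
    rewrite (bigD1 i) //= eqxx mul1r big1 ?addr0 // => k ki.
    by rewrite (negPf ki) mul0r.
  rewrite (bigD1 j) //= eqxx mul1r big1 ?addr0 // => k ki.
  by rewrite (negPf ki) mul0r.
have cE (z : C) (k : 'I_n) : conjc ((k == i)%:R + z * (k == j)%:R)
    = (k == i)%:R + conjc z * (k == j)%:R.
  by rewrite rmorphD rmorphM /= !conjc_nat.
have q (z : C) : 0 <= A i i + z * A i j + conjc z * (A j i + z * A j j).
  have := psdA (\col_k ((k == i)%:R + z * (k == j)%:R)); rewrite quadE.
  under eq_bigr => k _.
    under eq_bigr => l _ do rewrite !mxE cE -mulrA.
    rewrite -mulr_sumr pick.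
    over.
  by rewrite pick.
have jj : 0 <= A j j.
  have := psdA (\col_k (k == j)%:R); rewrite quadE.
  under eq_bigr => k _.
    under eq_bigr => l _ do rewrite !mxE conjc_nat -mulrA.
    rewrite -mulr_sumr (bigD1 j) //= eqxx mul1r big1 ?addr0; last first.
      by move=> l /negPf ->; rewrite mul0r.
    over.
  rewrite (bigD1 j) //= eqxx mul1r big1 ?addr0 // => l /negPf ->.
  by rewrite mul0r.
have := q 0; have := q 1; have := q 'i%C; move: jj.
move=> /ger0_Im + /ger0_Im + /ger0_Im + /ger0_Im.
case: (A i i) (A i j) (A j i) (A j j) => [a a'] [b b'] [c c'] [d d'] /=.
simpc => /= -> h1 h2 h3.
apply/eqP; rewrite eq_complex /=; apply/andP; split; apply/eqP; lra.
Qed.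

(** A sum of congruences is the form in which positivity is visibly preserved. *)
Lemma idtens_kraus m (K : 'I_m -> 'M[C]_2) n (X : 'M[C]_(n * 2)) :
  idtens (kraus_map K) X =
  \sum_i ((1%:M : 'M[C]_n) *t K i) *m X *m ((1%:M : 'M[C]_n) *t K i) ^t*.
Proof.
apply: eq_block => a b; rewrite block_idtens block_sum; apply: eq_bigr => i _.
have -> : ((1%:M : 'M[C]_n) *t K i) ^t* = (1%:M : 'M[C]_n) *t (K i) ^t*.
  by rewrite adj_tens; congr (_ *t _); apply/matrixP => k l; rewrite adjE !mxE conjc_nat eq_sym.
by rewrite block_mulmx sum_one_mx.
Qed.

Lemma kraus_completely_positive m (K : 'I_m -> 'M[C]_2) :
  completely_positive (kraus_map K).
Proof.
by move=> n X psdX; rewrite idtens_kraus; apply: psd_sum => i; apply: psd_congr.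
Qed.

Lemma kraus_linear m (K : 'I_m -> 'M[C]_2) : linear (kraus_map K).
Proof.
move=> c X Y; rewrite /kraus_map scaler_sumr -big_split /=; apply: eq_bigr => i _.
by rewrite mulmxDr mulmxDl -scalemxAr -scalemxAl.
Qed.

Lemma sqrt2C : ((Num.sqrt 2)^-1)%:C * ((Num.sqrt 2)^-1)%:C = 2^-1 :> C.
Proof.
rewrite -rmorphM -invfM -expr2 sqr_sqrtr ?ler0n //.
by rewrite fmorphV rmorph_nat.
Qed.

Lemma ket_tensE (k1 k2 k l : 'I_2) :
  (ket R k1 *t ket R k2 : 'cV[C]_(2 * 2)) (mxtens_index (k, l)) 0
  = (k == k1)%:R * (l == k2)%:R.
Proof.
have -> : (0 : 'I_1) = mxtens_index (0 : 'I_1, 0 : 'I_1) :> 'I_(1 * 1) by exact: val_inj.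
by rewrite [LHS](tensmxE (ket R k1) (ket R k2) k l 0 0) !mxE !andbT.
Qed.

(** This is what makes the blocks of [choi L] the values of [L] on the matrix units, up to the
    factor 1/2. *)
Lemma block_bell a b :
  block (bell_phi R *m (bell_phi R) ^t*) a b = 2^-1 *: delta_mx a b.
Proof.
apply/matrixP => i j; rewrite blockE mxE big_ord1 adjE.
have bellE (k l : 'I_2) :
    bell_phi R (mxtens_index (k, l)) 0 = ((Num.sqrt 2)^-1)%:C * (k == l)%:R.
  rewrite mxE mxE !ket_tensE.
  by elim/ord2P: k; elim/ord2P: l; rewrite //=; ring.
rewrite !bellE conjcM conjc_nat conjc_real.
rewrite !mxE mulrACA sqrt2C -natrM mulnb; congr (_ * _%:R).
by elim/ord2P: a; elim/ord2P: b; elim/ord2P: i; elim/ord2P: j.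
Qed.

Lemma block_choi (L : 'M[C]_2 -> 'M[C]_2) a b :
  block (choi L) a b = L (2^-1 *: delta_mx a b).
Proof. by rewrite block_idtens block_bell. Qed.

End BlockCalculus.

(** * Teleportation fidelity *)

Section TeleportationFidelity.
Variable R : realType.
Local Notation C := R[i].

Lemma mul_mx2 (a b c d a' b' c' d' : C) :
  mx2 a b c d *m mx2 a' b' c' d' =
  mx2 (a * a' + b * c') (a * b' + b * d') (c * a' + d * c') (c * b' + d * d').
Proof. by apply: eq_mx2; rewrite mxE sum2 !mx2E. Qed.

Lemma adj_mx2 (a b c d : C) :
  (mx2 a b c d) ^t* = mx2 (conjc a) (conjc c) (conjc b) (conjc d).
Proof. by apply: eq_mx2; rewrite adjE !mx2E. Qed.

Lemma mul2E (A B : 'M[C]_2) i j : (A *m B) i j = A i 0 * B 0 j + A i 1 * B 1 j.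
Proof. by rewrite mxE sum2. Qed.

Lemma pauli0E : pauli R 0 = mx2 1 0 0 1.
Proof. by apply: eq_mx2; rewrite !mxE. Qed.

Lemma pauliE : ((pauli R 0 = mx2 1 0 0 1) * (pauli R 1 = mx2 0 1 1 0) *
  (pauli R 2 = mx2 0 (- 'i%C) 'i%C 0) * (pauli R 3 = mx2 1 0 0 (- 1)))%type.
Proof. by rewrite pauli0E. Qed.

Lemma singletE (k l : 'I_2) : singlet R (mxtens_index (k, l)) 0 =
  ((Num.sqrt 2)^-1)%:C * ((k == 0) && (l == 1))%:R
  - ((Num.sqrt 2)^-1)%:C * ((k == 1) && (l == 0))%:R.
Proof.
rewrite mxE mxE [(- _ : 'M[C]_(_, _)) _ _]mxE !ket_tensE -!mulnb !natrM; ring.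
Qed.

Lemma bellE k (a b : 'I_2) : bell R k (mxtens_index (a, b)) 0 =
  ((Num.sqrt 2)^-1)%:C * (if b == 0 then - pauli R k a 1 else pauli R k a 0).
Proof.
rewrite mxE sum_mxtens sum2 !sum2.
rewrite !(tensmxE (pauli R k) (1%:M : 'M[C]_2)) !singletE.
by elim/ord2P: b; rewrite !mxE /=; ring.
Qed.

Lemma receiverE rho (psi : 'cV[C]_2) k i j : receiver rho psi k i j =
  \sum_b \sum_d
    (\sum_a conjc (bell R k (mxtens_index (a, b)) 0) * psi a 0) *
    (\sum_c bell R k (mxtens_index (c, d)) 0 * conjc (psi c 0)) *
    block rho b d i j.
Proof.
have colE (a b e : 'I_2) :
    ((bell R k) ^t* *t (1%:M : 'M[C]_2) : 'M[C]_(1 * 2, 2 * 2 * 2))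
      i (mxtens_index (mxtens_index (a, b), e))
    = conjc (bell R k (mxtens_index (a, b)) 0) * (i == e)%:R.
  have -> : i = mxtens_index (0 : 'I_1, i : 'I_2) :> 'I_(1 * 2) by exact: val_inj.
  rewrite [LHS](tensmxE ((bell R k) ^t*) (1%:M : 'M[C]_2) 0 i).
  by rewrite adjE [_%:M _ _]mxE; congr (_ * (nat_of_bool _)%:R); congr (_ == _); exact: val_inj.
have rowE (a b e : 'I_2) :
    (bell R k *t (1%:M : 'M[C]_2) : 'M[C]_(2 * 2 * 2, 1 * 2))
      (mxtens_index (mxtens_index (a, b), e)) j
    = bell R k (mxtens_index (a, b)) 0 * (e == j)%:R.
  have -> : j = mxtens_index (0 : 'I_1, j) :> 'I_(1 * 2) by exact: val_inj.
  rewrite [LHS](tensmxE (bell R k) (1%:M : 'M[C]_2) (mxtens_index (a, b)) e 0 j).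
  by rewrite [_%:M _ _]mxE; congr (_ * (nat_of_bool _)%:R); congr (_ == _); exact: val_inj.
have midE (a b e c d f : 'I_2) :
    ((psi *m psi ^t*) *t rho : 'M[C]_(2 * 2 * 2))
      (mxtens_index (mxtens_index (a, b), e)) (mxtens_index (mxtens_index (c, d), f))
    = psi a 0 * conjc (psi c 0) * block rho b d e f.
  (* The measurement groups the input with the sender's half, whereas the global state groups the
     sender's half with the receiver's; the two encodings of a triple coincide. *)
  have assoc (x y z : 'I_2) : mxtens_index (mxtens_index (x, y), z)
      = mxtens_index (x, mxtens_index (y, z)) :> 'I_(2 * 2 * 2).
    by apply: val_inj; rewrite /= mulnDl -mulnA addnA.
  rewrite (assoc a b e) (assoc c d f).
  rewrite [LHS](tensmxE (psi *m psi ^t*) rho a (mxtens_index (b, e)) c (mxtens_index (d, f))).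
  by rewrite mxE big_ord1 adjE -blockE.
have pick (x : C) (e0 : 'I_2) (F : 'I_2 -> C) : \sum_e x * (e0 == e)%:R * F e = x * F e0.
  by rewrite sum2; elim/ord2P: e0; rewrite /=; ring.
rewrite mxE sum_mxtens [LHS]sum_mxtens /=.
under eq_bigr => c _.
  under eq_bigr => d _.
    under eq_bigr => f _.
      rewrite rowE mxE sum_mxtens sum_mxtens /=.
      under eq_bigr => a _.
        under eq_bigr => b _.
          under eq_bigr => e _ do rewrite colE midE.
          rewrite pick.
          over.
        over.
      rewrite mulrC (eq_sym f).
      over.
    rewrite pick.
    over.
  over.
rewrite /= !sum2; ring.
Qed.

Lemma teleport_form rho (psi : 'cV[C]_2) :
  (psi ^t* *m teleport rho psi *m psi) 0 0 =
  \sum_(k < 4) \sum_i \sum_j (psi ^t* *m pauli R k) 0 i * receiver rho psi k i j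
     * conjc ((psi ^t* *m pauli R k) 0 j).
Proof.
rewrite /teleport mulmx_sumr mulmx_suml summxE; apply: eq_bigr => k _.
have -> : psi ^t* *m (pauli R k *m receiver rho psi k *m (pauli R k) ^t*) *m psi
   = (psi ^t* *m pauli R k) *m receiver rho psi k *m (psi ^t* *m pauli R k) ^t*.
  by rewrite adj_mul adjK !mulmxA.
rewrite mxE exchange_big /=; apply: eq_bigr => j _; rewrite mxE mulr_suml adjE.
by apply: eq_bigr => i _.
Qed.

Lemma mulii : 'i%C * 'i%C = -1 :> C.
Proof. by rewrite -expr2 sqr_i. Qed.

Lemma tr_pauli11 (X : 'M[C]_(2 * 2)) : \tr (X *m (pauli R 1 *t pauli R 1)) =
  block X 0 1 0 1 + block X 0 1 1 0 + block X 1 0 0 1 + block X 1 0 1 0.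
Proof. rewrite tr_mul_tens !sum2 !tr2 !mul2E !pauliE !mx2E; ring. Qed.

Lemma tr_pauli22 (X : 'M[C]_(2 * 2)) : \tr (X *m (pauli R 2 *t pauli R 2)) =
  block X 0 1 1 0 - block X 0 1 0 1 + block X 1 0 0 1 - block X 1 0 1 0.
Proof.
rewrite tr_mul_tens !sum2 !tr2 !mul2E !pauliE !mx2E.
set i := 'i%C.
transitivity ((i * i) * - (block X 0 1 1 0 - block X 0 1 0 1 + block X 1 0 0 1 - block X 1 0 1 0)).
  ring.
by rewrite mulii; ring.
Qed.

Lemma tr_pauli33 (X : 'M[C]_(2 * 2)) : \tr (X *m (pauli R 3 *t pauli R 3)) =
  block X 0 0 0 0 - block X 0 0 1 1 - block X 1 1 0 0 + block X 1 1 1 1.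
Proof. rewrite tr_mul_tens !sum2 !tr2 !mul2E !pauliE !mx2E; ring. Qed.

Lemma tr_blocks (X : 'M[C]_(2 * 2)) : \tr X =
  block X 0 0 0 0 + block X 0 0 1 1 + block X 1 1 0 0 + block X 1 1 1 1.
Proof. by rewrite /mxtrace sum_mxtens !sum2 -!blockE addrA. Qed.

Definition pair2 (x y : C) (i : 'I_2) : C := if i == 0 then x else y.

Lemma pair2E x y : ((pair2 x y 0 = x) * (pair2 x y 1 = y))%type.
Proof. by []. Qed.

(** The four vectors are independent arguments, not two conjugate pairs, so that phases and the
    factor 1/sqrt 2 can be pulled out of each one and a polynomial identity without conjugation
    remains. *)
Definition contract (X : 'M[C]_(2 * 2)) (u u' w w' : 'I_2 -> C) : C :=
  \sum_b \sum_d \sum_i \sum_j (u b * u' d) * (w i * w' j) * block X b d i j.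

Lemma contractZ X u u' w w' c c' e e' : contract X (fun i => c * u i)
   (fun i => c' * u' i) (fun i => e * w i) (fun i => e' * w' i)
  = c * c' * (e * e') * contract X u u' w w'.
Proof.
rewrite /contract mulr_sumr; apply: eq_bigr => b _.
rewrite mulr_sumr; apply: eq_bigr => d _.
rewrite mulr_sumr; apply: eq_bigr => i _.
by rewrite mulr_sumr; apply: eq_bigr => j _; ring.
Qed.

(** The partial inner product of the k-th Bell vector with the input: the functional that outcome k
    applies to the sender's half of the shared state. *)
Definition outcome (psi : 'cV[C]_2) (k : nat) (b : 'I_2) : C :=
  \sum_a conjc (bell R k (mxtens_index (a, b)) 0) * psi a 0.

Definition outcome_form rho (psi : 'cV[C]_2) (k : nat) : C :=
  contract rho (outcome psi k) (fun d => conjc (outcome psi k d))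
     (fun i => (psi ^t* *m pauli R k) 0 i)
     (fun j => conjc ((psi ^t* *m pauli R k) 0 j)).

Lemma sum4_nat (V : nmodType) (F : nat -> V) :
  \sum_(k < 4) F k = F 0%N + F 1%N + F 2%N + F 3%N.
Proof. by rewrite 4!big_ord_recl big_ord0 addr0 !addrA. Qed.

Lemma teleport_contract rho (psi : 'cV[C]_2) :
  (psi ^t* *m teleport rho psi *m psi) 0 0 =
  outcome_form rho psi 0 + outcome_form rho psi 1
  + outcome_form rho psi 2 + outcome_form rho psi 3.
Proof.
rewrite -(sum4_nat (outcome_form rho psi)) teleport_form; apply: eq_bigr => k _.
rewrite /outcome_form /contract; under [RHS]eq_bigr => b _ do rewrite exchange_big.
rewrite [RHS]exchange_big /=; apply: eq_bigr => i _.
under [RHS]eq_bigr => b _ do rewrite exchange_big.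
rewrite [RHS]exchange_big /=; apply: eq_bigr => j _.
rewrite receiverE mulr_sumr mulr_suml; apply: eq_bigr => b _.
rewrite mulr_sumr mulr_suml; apply: eq_bigr => d _.
by rewrite /outcome !sum2 conjcD !conjcM !conjcK; ring.
Qed.

Lemma eq_contract X u u' w w' v v' z z' : u =1 v -> u' =1 v' -> w =1 z ->
  w' =1 z' -> contract X u u' w w' = contract X v v' z z'.
Proof. by move=> /funext-> /funext-> /funext-> /funext->. Qed.

(** Summing over the four outcomes is a Pauli twirl: local terms and off-diagonal correlations
    cancel. For a unit vector the combinations of p and q are 1, n_1, i n_2 and n_3, with n the
    Bloch vector of the input; the factor i explains the plus sign before the second square. *)
Lemma teleport_bloch rho (p q : C) (psi := \col_(k < 2) (if k == 0 then p else q)) :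
  (psi ^t* *m teleport rho psi *m psi) 0 0 = 2^-1 *
  ((p * conjc p + q * conjc q) ^+ 2 * \tr rho
   - (q * conjc p + p * conjc q) ^+ 2 * \tr (rho *m (pauli R 1 *t pauli R 1))
   + (q * conjc p - p * conjc q) ^+ 2 * \tr (rho *m (pauli R 2 *t pauli R 2))
   - (p * conjc p - q * conjc q) ^+ 2 * \tr (rho *m (pauli R 3 *t pauli R 3))).
Proof.
rewrite teleport_contract tr_pauli11 tr_pauli22 tr_pauli33 tr_blocks.
have p0 : psi 0 0 = p by rewrite mxE.
have p1 : psi 1 0 = q by rewrite mxE.
have wE k (i : 'I_2) : (psi ^t* *m pauli R k) 0 i
    = conjc p * pauli R k 0 i + conjc q * pauli R k 1 i.
  by rewrite mxE sum2 !adjE p0 p1.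
set s := ((Num.sqrt 2)^-1)%:C : C.
have uE0 k : outcome psi k 0 =
    s * (- conjc (pauli R k 0 1) * p - conjc (pauli R k 1 1) * q).
  by rewrite /outcome sum2 !bellE p0 p1 eqxx !(conjcM, conjcN, conjc_real); ring.
have uE1 k : outcome psi k 1 =
    s * (conjc (pauli R k 0 0) * p + conjc (pauli R k 1 0) * q).
  by rewrite /outcome sum2 !bellE p0 p1 /= !(conjcM, conjcN, conjc_real); ring.
have cs : conjc s = s by rewrite conjc_real.
(* The scalars c and e are phases that cancel against their conjugates; they differ from 1 only for
   the second Pauli matrix. The factor 1/2 is the square of the Bell normalisation. *)
have main (k : nat) (u v w z : 'I_2 -> C) (c e : C) : c * conjc c = 1 -> e * conjc e = 1 ->
    (forall b, outcome psi k b = (s * c) * u b) ->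
    (forall b, conjc (u b) = v b) ->
    (forall i, (psi ^t* *m pauli R k) 0 i = e * w i) ->
    (forall b, conjc (w b) = z b) ->
    outcome_form rho psi k = 2^-1 * contract rho u v w z.
  move=> c1 e1 hu hv hw hz.
  rewrite /outcome_form (eq_contract rho hu (v' := fun b => (s * conjc c) * v b) _ hw (z' := fun b => conjc e * z b)).
  - rewrite contractZ e1 mulr1; congr (_ * _).
    by rewrite mulrACA c1 mulr1 sqrt2C.
  - by move=> b; rewrite hu !conjcM cs hv.
  - by move=> b; rewrite hw !conjcM hz.
have n1 : 1 * conjc (1 : C) = 1 by rewrite conjc1 mulr1.
have ni : 'i%C * conjc ('i%C : C) = 1 by rewrite conjc_i mulrN mulii opprK.
have -> : outcome_form rho psi 0 = 2^-1 * contract rho (pair2 (- q) p)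
    (pair2 (- conjc q) (conjc p)) (pair2 (conjc p) (conjc q)) (pair2 p q).
  apply: (main 0%N _ _ _ _ 1 1) => //; apply: ord2P;
  by rewrite ?wE ?(uE0, uE1) ?pauliE ?mx2E ?pair2E ?conjcN ?conjcK ?conjc0 ?conjc1; ring.
have -> : outcome_form rho psi 1 = 2^-1 * contract rho (pair2 (- p) q)
    (pair2 (- conjc p) (conjc q)) (pair2 (conjc q) (conjc p)) (pair2 q p).
  apply: (main 1%N _ _ _ _ 1 1) => //; apply: ord2P;
  by rewrite ?wE ?(uE0, uE1) ?pauliE ?mx2E ?pair2E ?conjcN ?conjcK ?conjc0 ?conjc1; ring.
have -> : outcome_form rho psi 2 = 2^-1 * contract rho (pair2 p q)
    (pair2 (conjc p) (conjc q)) (pair2 (conjc q) (- conjc p)) (pair2 q (- p)).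
  apply: (main 2%N _ _ _ _ (- 'i%C) 'i%C) => //; try (apply: ord2P;
  by rewrite ?wE ?(uE0, uE1) ?pauliE ?mx2E ?pair2E ?conjcN ?conjcK ?conjc0 ?conjc1 ?conjc_i; ring).
  by rewrite conjcN mulrNN.
have -> : outcome_form rho psi 3 = 2^-1 * contract rho (pair2 q p)
    (pair2 (conjc q) (conjc p)) (pair2 (conjc p) (- conjc q)) (pair2 p (- q)).
  apply: (main 3%N _ _ _ _ 1 1) => //; apply: ord2P;
  by rewrite ?wE ?(uE0, uE1) ?pauliE ?mx2E ?pair2E ?conjcN ?conjcK ?conjc0 ?conjc1; ring.
rewrite /contract !sum2 !pair2E; ring.
Qed.
End TeleportationFidelity.

(** * Averages over the Bloch sphere *)

Section BlochSphere.
Variable R : realType.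
Local Notation C := R[i].
Local Notation mu := (@lebesgue_measure R).

Lemma Rintegral_FTC (f F : R -> R) (a b : R) : a < b -> continuous f ->
  (forall x : R, is_derive x 1 F (f x)) -> \int[mu]_(x in `[a, b]) f x = F b - F a.
Proof.
move=> ab cf dF.
have cF : continuous F.
  by move=> x; apply/differentiable_continuous/derivable1_diffP; have [] := dF x.
rewrite /Rintegral (@continuous_FTC2 _ _ F) //.
- exact/continuous_subspaceT.
- split.
  + by move=> x _; have [] := dF x.
  + by apply: cvg_at_right_filter; exact: cF.
  + by apply: cvg_at_left_filter; exact: cF.
- by move=> x _; rewrite derive1E; have [_] := dF x.
Qed.

Lemma cos_sin_sq (x : R) : sin x * sin x = 1 - cos x * cos x.
Proof. by rewrite -!expr2 sin2cos2. Qed.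

Lemma continuous_cos_quartic (u v w : R) : continuous (fun x =>
  u + v * (cos x * cos x) + w * ((cos x * cos x) * (cos x * cos x))).
Proof.
move=> x.
have c2 : cos y * cos y @[y --> x] --> cos x * cos x.
  by apply: cvgM; exact: continuous_cos.
apply: cvgD; last by apply: cvgM; [exact: cvg_cst|exact: (cvgM c2 c2)].
by apply: cvgD; [exact: cvg_cst|apply: cvgM; [exact: cvg_cst|exact: c2]].
Qed.

(** The constants 1/2 and 3/8 are the means of cos^2 and cos^4 over a period; the periodic part of
    the primitive vanishes at both ends. *)
Lemma integral_cos_quartic (u v w : R) :
  \int[mu]_(b in `[0, 2 * pi]) (u + v * (cos b * cos b) + w * ((cos b * cos b) * (cos b * cos b)))
  = 2 * pi * (u + v / 2 + 3 / 8 * w).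
Proof.
pose F (x : R) := (u + v / 2 + 3 / 8 * w) * x + ((v / 2 + 3 / 8 * w) * (sin x * cos x)
   + w / 4 * (sin x * cos x) * (cos x * cos x)).
etransitivity; first apply: (@Rintegral_FTC _ F).
- by rewrite mulr_gt0 // pi_gt0.
- by move=> x; apply: continuous_cos_quartic.
- move=> x; rewrite /F; apply: is_derive_eq.
  rewrite /GRing.scale /=.
  have := cos_sin_sq x; set s := sin x; set c := cos x => h.
  transitivity (u + v / 2 + 3 / 8 * w + (v / 2 + 3 / 8 * w) * (c * c - s * s)
    + w / 4 * ((c * c - s * s) * (c * c) - 2 * (s * s) * (c * c))); first by ring.
  by rewrite h; field.
- have e : 2 * pi = pi *+ 2 :> R by rewrite mulr_natl.
  by rewrite /F e sin2pi sin0; ring.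
Qed.

(** Under x = cos a this integrates an even polynomial over [-1, 1], whence 1/3 and 1/5. *)
Lemma integral_cos_quartic_sin (u v w : R) :
  \int[mu]_(a in `[0, pi]) ((u + v * (cos a * cos a) + w * ((cos a * cos a) * (cos a * cos a))) * sin a)
  = 2 * (u + v / 3 + w / 5).
Proof.
pose F (x : R) := - (u * cos x + v / 3 * (cos x * (cos x * cos x))
   + w / 5 * (cos x * ((cos x * cos x) * (cos x * cos x)))).
etransitivity; first apply: (@Rintegral_FTC _ F).
- exact: pi_gt0.
- by move=> x; apply: cvgM; [exact: continuous_cos_quartic|exact: continuous_sin].
- move=> x; rewrite /F; apply: is_derive_eq.
  by rewrite /GRing.scale /=; field.
- by rewrite /F cospi cos0; field.
Qed.

Lemma bloch_ketE (a b : R) : bloch_ket a b = \col_(k < 2)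
  (if k == 0 then (cos (a / 2))%:C else (cos b * sin (a / 2)) +i* (sin b * sin (a / 2))).
Proof.
apply/matrixP => i j; rewrite !mxE (ord1 j) andbT /= andbT.
elim/ord2P: i => /=; simpc; congr Complex; ring.
Qed.

Lemma correlation_diag (rho : 'M[C]_(2 * 2)) :
  correlation rho 0 0 = complex.Re (\tr (rho *m (pauli R 1 *t pauli R 1))) /\
  correlation rho 1 1 = complex.Re (\tr (rho *m (pauli R 2 *t pauli R 2))) /\
  correlation rho 2 2 = complex.Re (\tr (rho *m (pauli R 3 *t pauli R 3))).
Proof.
have e1 : nat_of_ord (1 : 'I_3) = 1%N by [].
have e2 : nat_of_ord (2 : 'I_3) = 2%N by [].
by split; [rewrite mxE | split; [rewrite mxE e1 | rewrite mxE e2]].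
Qed.

Lemma fidelity_bloch (rho : 'M[C]_(2 * 2)) (a b : R)
    (T := correlation rho) :
  fidelity rho (bloch_ket a b) = 2^-1 * (complex.Re (\tr rho)
   - (sin a * cos b) ^+ 2 * T 0 0 - (sin a * sin b) ^+ 2 * T 1 1
   - cos a ^+ 2 * T 2 2).
Proof.
have e : a = (a / 2) *+ 2 by rewrite -mulr_natr mulfVK // pnatr_eq0.
have sa : sin a = 2 * (cos (a / 2) * sin (a / 2)).
  by rewrite {1}e sin_mulr2n mulr_natl.
have ca : cos a = cos (a / 2) * cos (a / 2) - sin (a / 2) * sin (a / 2).
  by rewrite {1}e cos_mulr2n cos_sin_sq expr2 mulr2n; ring.
have [T0 [T1 T2]] := correlation_diag rho.
rewrite /fidelity bloch_ketE teleport_bloch sa ca /T T0 T1 T2 {T0 T1 T2 T}.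
have n1 : cos (a / 2) * cos (a / 2) + sin (a / 2) * sin (a / 2) = 1.
  by rewrite cos_sin_sq; ring.
have n2 : cos b * cos b + sin b * sin b = 1.
  by rewrite cos_sin_sq; ring.
move: n1 n2; set c := cos (a / 2); set s := sin (a / 2); set x := cos b; set y := sin b.
move=> n1 n2.
move: (\tr rho) (\tr (rho *m (pauli R 1 *t pauli R 1)))
  (\tr (rho *m (pauli R 2 *t pauli R 2))) (\tr (rho *m (pauli R 3 *t pauli R 3))).
move=> t0 t1 t2 t3.
have -> : c%:C * conjc c%:C + ((x * s) +i* (y * s)) * conjc ((x * s) +i* (y * s)) = 1.
  by apply/eqP; rewrite eq_complex; apply/andP; split; apply/eqP; simpc => /=; nra.
have -> : ((x * s) +i* (y * s)) * conjc c%:C + c%:C * conjc ((x * s) +i* (y * s)) = (2 * (c * s) * x)%:C.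
  by apply/eqP; rewrite eq_complex; apply/andP; split; apply/eqP; simpc => /=; ring.
have -> : ((x * s) +i* (y * s)) * conjc c%:C - c%:C * conjc ((x * s) +i* (y * s)) = 'i%C * (2 * (c * s) * y)%:C.
  by apply/eqP; rewrite eq_complex; apply/andP; split; apply/eqP; simpc => /=; ring.
have -> : c%:C * conjc c%:C - ((x * s) +i* (y * s)) * conjc ((x * s) +i* (y * s)) = (c * c - s * s)%:C.
  apply/eqP; rewrite eq_complex; apply/andP; split; apply/eqP; simpc => /=; last by ring.
  transitivity (c * c - s * s * (x * x + y * y)); first ring.
  by rewrite n2; ring.
rewrite [(_ * _%:C) ^+ 2]expr2 mulrACA mulii -!rmorphXn -!rmorphM expr1n.
have -> : 2^-1 = (2^-1)%:C :> C by rewrite fmorphV rmorph_nat.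
case: t0 t1 t2 t3 => [t0 t0'] [t1 t1'] [t2 t2'] [t3 t3'].
by simpc => /=; ring.
Qed.

Section Means.
Variables (g : 'cV[C]_2 -> R) (a0 a1 b0 : R).
Hypothesis gE : forall a b, g (bloch_ket a b) =
  a0 + a1 * (cos a * cos a) + b0 * (1 - cos a * cos a) * (cos b * cos b).

(** By hypothesis g is a0 + a1 n_3^2 + b0 n_1^2, and each squared coordinate has mean 1/3 on the
    sphere. *)
Lemma bloch_mean_affine : bloch_mean g = a0 + a1 / 3 + b0 / 3.
Proof.
have pi0 : pi != 0 :> R by rewrite gt_eqF // pi_gt0.
rewrite /bloch_mean (_ : (fun a => _) = fun a =>
  (2 * pi * (a0 + b0 / 2) + 2 * pi * (a1 - b0 / 2) * (cos a * cos a)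
   + 0 * ((cos a * cos a) * (cos a * cos a))) * sin a).
  by rewrite integral_cos_quartic_sin; move: (@pi R) pi0 => p p0; field.
apply/funext => a; rewrite (_ : (fun b => _) = fun b =>
  (a0 + a1 * (cos a * cos a)) * sin a
  + (b0 * (1 - cos a * cos a) * sin a) * (cos b * cos b)
  + 0 * ((cos b * cos b) * (cos b * cos b))); last first.
  by apply/funext => b; rewrite gE; ring.
by rewrite integral_cos_quartic; move: (@pi R) pi0 => p p0; field.
Qed.

(** The three groups are the coefficients of 1, cos^2 a and cos^4 a left after averaging over b,
    weighted by 1, 1/3 and 1/5. *)
Lemma bloch_mean_affine_sq : bloch_mean (fun psi => g psi ^+ 2) =
  (a0 ^+ 2 + a0 * b0 + 3 / 8 * b0 ^+ 2)
  + (2 * a0 * a1 + a1 * b0 - a0 * b0 - 3 / 4 * b0 ^+ 2) / 3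
  + (a1 ^+ 2 - a1 * b0 + 3 / 8 * b0 ^+ 2) / 5.
Proof.
have pi0 : pi != 0 :> R by rewrite gt_eqF // pi_gt0.
rewrite /bloch_mean (_ : (fun a => _) = fun a =>
  (2 * pi * (a0 ^+ 2 + a0 * b0 + 3 / 8 * b0 ^+ 2)
   + 2 * pi * (2 * a0 * a1 + a1 * b0 - a0 * b0 - 3 / 4 * b0 ^+ 2) * (cos a * cos a)
   + 2 * pi * (a1 ^+ 2 - a1 * b0 + 3 / 8 * b0 ^+ 2) * ((cos a * cos a) * (cos a * cos a)))
  * sin a).
  by rewrite integral_cos_quartic_sin; move: (@pi R) pi0 => p p0; field.
apply/funext => a; rewrite (_ : (fun b => _) = fun b =>
  (a0 + a1 * (cos a * cos a)) ^+ 2 * sin a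
  + (2 * (a0 + a1 * (cos a * cos a)) * (b0 * (1 - cos a * cos a)) * sin a) * (cos b * cos b)
  + (b0 * (1 - cos a * cos a)) ^+ 2 * sin a * ((cos b * cos b) * (cos b * cos b))); last first.
  by apply/funext => b; rewrite gE; ring.
by rewrite integral_cos_quartic; move: (@pi R) pi0 => p p0; field.
Qed.
End Means.

Lemma fidelity_affine (rho : 'M[C]_(2 * 2)) (T := correlation rho) a b :
  fidelity rho (bloch_ket a b) =
  2^-1 * (complex.Re (\tr rho) - T 1 1) + 2^-1 * (T 1 1 - T 2 2) * (cos a * cos a)
  + 2^-1 * (T 1 1 - T 0 0) * (1 - cos a * cos a) * (cos b * cos b).
Proof.
rewrite fidelity_bloch -/T !exprMn !expr2 !cos_sin_sq; ring.
Qed.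

Lemma average_fidelityE (rho : 'M[C]_(2 * 2)) : average_fidelity rho =
  2^-1 * (complex.Re (\tr rho) - \tr (correlation rho) / 3).
Proof.
rewrite /average_fidelity (bloch_mean_affine (fidelity_affine rho)).
set T := correlation rho.
have -> : \tr T = T 0 0 + T 1 1 + T 2 2.
  rewrite /mxtrace !big_ord_recr big_ord0 /= add0r.
  by congr (T _ _ + T _ _ + T _ _); apply: val_inj.
by field.
Qed.

(** Since 90 = (3 sqrt 10)^2, this is the square of the closed formula for the deviation, with
    signed diagonal entries in place of their moduli. *)
Lemma fidelity_variance (rho : 'M[C]_(2 * 2)) (T := correlation rho) :
  bloch_mean (fun psi => (fidelity rho psi - average_fidelity rho) ^+ 2) =
  ((T 0 0 - T 1 1) ^+ 2 + (T 0 0 - T 2 2) ^+ 2 + (T 1 1 - T 2 2) ^+ 2) / 90.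
Proof.
have gE a b : fidelity rho (bloch_ket a b) - average_fidelity rho =
  (2^-1 * (complex.Re (\tr rho) - T 1 1) - average_fidelity rho)
  + 2^-1 * (T 1 1 - T 2 2) * (cos a * cos a)
  + 2^-1 * (T 1 1 - T 0 0) * (1 - cos a * cos a) * (cos b * cos b).
  by rewrite fidelity_affine -/T; ring.
rewrite (bloch_mean_affine_sq (g := fun psi => fidelity rho psi - average_fidelity rho) gE).
rewrite /average_fidelity (bloch_mean_affine (fidelity_affine rho)) -/T.
by field.
Qed.

Lemma fidelity_sd_eq0 (rho : 'M[C]_(2 * 2)) (T := correlation rho) :
  fidelity_sd rho = 0 <-> T 0 0 = T 1 1 /\ T 1 1 = T 2 2.
Proof.
rewrite /fidelity_sd fidelity_variance -/T; split; last first.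
  by move=> [-> ->]; rewrite !subrr !expr0n /= !addr0 mul0r sqrtr0.
move/eqP; rewrite sqrtr_eq0 => h.
have h1 := sqr_ge0 (T 0 0 - T 1 1).
have h2 := sqr_ge0 (T 0 0 - T 2 2).
have h3 := sqr_ge0 (T 1 1 - T 2 2).
split; apply/eqP; rewrite -subr_eq0 -sqrf_eq0; apply/eqP; lra.
Qed.
End BlochSphere.

(** * The Kraus operators without their removable singularities *)

Section KrausLimit.
Variable R : realType.
Local Notation C := R[i].

(** The difference quotient f(x) / (x - a) tends to d, which is nonzero, so f(x) is nonzero at
    nearby x other than a. *)
Lemma isolated_simple_zero (f : R -> R) (a d : R) :
  is_derive a 1 f d -> d != 0 -> f a = 0 -> \forall x \near a^', f x != 0.
Proof.
move=> [df fd] d0 fa0.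
have : h^-1 *: ((f \o shift a) (h *: (1 : R)) - f a) @[h --> (0 : R)^'] --> d.
  by rewrite -fd; exact: df.
move=> /cvgr_neq0 /(_ d0).
rewrite /= => /nbhs_ballP [e /= e_gt0 he]; apply/nbhs_ballP; exists e => //= x.
rewrite /ball /= => xe xa.
have /= := he (x - a); rewrite /ball /= sub0r opprB subr_eq0 => /(_ xe xa).
rewrite fa0 subr0 scaler_eq0 negb_or [_ *: _]mulr1 subrK.
by case/andP.
Qed.

Lemma expiN (x : R) : expi (- x) = conjc (expi x).
Proof. by rewrite /expi cosN sinN. Qed.

Lemma expi_unit (x : R) : expi x * conjc (expi x) = 1.
Proof.
have := cos2Dsin2 x; rewrite /expi !expr2 => h.
by apply/eqP; rewrite eq_complex /=; apply/andP; split; apply/eqP; simpc => /=; lra.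
Qed.

(** The angle-free factor of [y0] at r = R and of [y2] at r = -R. The other factor of each is, up to
    sign, the denominator that can be cancelled in the matrix. *)
Definition amp (t r : R) : R :=
  Num.sqrt ((1 + t + r) / ((1 - t) ^+ 2 + 2 * t * (2 * t + r))) / (2 * Num.sqrt 2).

(* [kraus_formula] with the removable singularities removed:
   [K_0] and [K_2] are proportional to [((R + 2 t) + (1 - t) n.sigma) eps] and
   [((R - 2 t) - (1 - t) n.sigma) eps], where [eps = i sigma_2] and [n] is the
   direction of [svec]. *)
Definition smooth_K0 (t th ph : R) : 'M[C]_2 := (amp t (Rad t))%:C *: mx2
  (- 'i%C * ((1 - t) * sin th)%:C * conjc (expi ph))
  ('i%C * (Rad t + 2 * t + (1 - t) * cos th)%:C)
  (- 'i%C * (Rad t + 2 * t - (1 - t) * cos th)%:C)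
  ('i%C * ((1 - t) * sin th)%:C * expi ph).

Definition smooth_K1 (t th ph : R) : 'M[C]_2 := (Num.sqrt (1 - t) / 2)%:C *: mx2
  (- 'i%C * (1 + cos th)%:C * conjc (expi ph))
  (- 'i%C * (sin th)%:C)
  (- 'i%C * (sin th)%:C)
  (- 'i%C * (1 - cos th)%:C * expi ph).

Definition smooth_K2 (t th ph : R) : 'M[C]_2 := (amp t (- Rad t))%:C *: mx2
  ('i%C * ((1 - t) * sin th)%:C * conjc (expi ph))
  ('i%C * (Rad t - 2 * t - (1 - t) * cos th)%:C)
  (- 'i%C * (Rad t - 2 * t + (1 - t) * cos th)%:C)
  (- 'i%C * ((1 - t) * sin th)%:C * expi ph).

Definition smooth_kraus (t th ph : R) (i : 'I_3) : 'M[C]_2 :=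
  match val i with
  | 0 => smooth_K0 t th ph
  | 1 => smooth_K1 t th ph
  | _ => smooth_K2 t th ph
  end.

Lemma ord3P (P : 'I_3 -> Prop) : P 0 -> P 1 -> P 2 -> forall i, P i.
Proof.
move=> P0 P1 P2 [[|[|[|//]]] lti].
- by have -> : Ordinal lti = 0 by exact: val_inj.
- by have -> : Ordinal lti = 1 by exact: val_inj.
- by have -> : Ordinal lti = 2 by exact: val_inj.
Qed.

Lemma Rad_sq (t : R) : Rad t ^+ 2 = (1 - t) ^+ 2 + 4 * t ^+ 2.
Proof. by rewrite sqr_sqrtr // addr_ge0 ?sqr_ge0 // mulr_ge0 ?sqr_ge0. Qed.

Lemma Rad_ge0 (t : R) : 0 <= Rad t. Proof. exact: sqrtr_ge0. Qed.

Lemma Rad_gt (t : R) : 0 < t < 1 -> 1 - t < Rad t /\ 2 * t < Rad t.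
Proof.
move=> /andP[t0 t1]; have := Rad_sq t; have := Rad_ge0 t; rewrite !expr2 => r0 r2.
by split; rewrite ltNge; apply/negP => h; nra.
Qed.

(** This rests on R^2 - 4 t^2 = (1 - t)^2. Up to sign the factors are the denominators on the
    diagonals of [K0] and [K2]; for 0 < t < 1 the first is positive, so only the second produces an
    exceptional angle. *)
Lemma Den_factor (t th : R) : Den t th =
  (Rad t + 2 * t - (1 - t) * cos th) * (Rad t - 2 * t + (1 - t) * cos th).
Proof.
rewrite /Den sin2cos2; have := Rad_sq t; set r := Rad t => h.
transitivity (r ^+ 2 - 4 * t ^+ 2 + 4 * t * (1 - t) * cos th - ((1 - t) * cos th) ^+ 2).
  by rewrite h; ring.
ring.
Qed.

Lemma y0E (t th : R) : y0 t th = (Rad t + 2 * t - (1 - t) * cos th) * amp t (Rad t).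
Proof. by rewrite /y0 /amp; ring. Qed.

Lemma y2E (t th : R) : y2 t th = (Rad t - 2 * t + (1 - t) * cos th) * amp t (- Rad t).
Proof. by rewrite /y2 /amp; ring. Qed.

Lemma scale_mx2 (k a b c d : C) : k *: mx2 a b c d = mx2 (k * a) (k * b) (k * c) (k * d).
Proof. by apply: eq_mx2; rewrite mxE !mx2E. Qed.

Lemma add_mx2 (a b c d a' b' c' d' : C) :
  mx2 a b c d + mx2 a' b' c' d' = mx2 (a + a') (b + b') (c + c') (d + d').
Proof. by apply: eq_mx2; rewrite mxE !mx2E. Qed.

Lemma kraus_formula_regular (t th ph : R) i : 0 < t < 1 -> kraus_regular t th ->
  kraus_formula t th ph i = smooth_kraus t th ph i.
Proof.
move=> t01 /and4P[s0 D0 P0 Q0].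
have rsq := Rad_sq t.
pose P := Rad t + 2 * t - (1 - t) * cos th.
pose Q := Rad t - 2 * t + (1 - t) * cos th.
have PE : (1 - t) * cos th - 2 * t - Rad t = - P by rewrite /P; ring.
have QE : (1 - t) * cos th - 2 * t + Rad t = Q by rewrite /Q; ring.
have P0' : P != 0 by move: P0; rewrite PE oppr_eq0.
have Q0' : Q != 0 by move: Q0; rewrite QE.
have PC : P%:C != 0 :> C by rewrite fmorph_eq0.
have QC : Q%:C != 0 :> C by rewrite fmorph_eq0.
have sC : (sin th)%:C != 0 :> C by rewrite fmorph_eq0.
have u := expi_unit ph.
have e0 : expi ph != 0.
  by apply/eqP => e; move: u; rewrite e mul0r => /esym/eqP; rewrite oner_eq0.
have e0' : conjc (expi ph) != 0 by rewrite conjc_eq0.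
have ce : conjc (expi ph) = (expi ph)^-1.
  by apply: (mulfI e0); rewrite u divff.
elim/ord3P: i; rewrite /kraus_formula /smooth_kraus /=.
- rewrite /K0 /smooth_K0 y0E !scale_mx2 expiN PE Den_factor -/P -/Q.
  have -> : - ((1 - t) * cos th) + 2 * t + Rad t = P by rewrite /P; ring.
  (* The numerator equals (R + (1 - t) cos th)^2 - 4 t^2, a difference of squares, and one of its
     factors cancels the factor Q of the denominator. *)
  have -> : (1 - t) ^+ 2 * (1 + cos th ^+ 2) + 2 * (1 - t) * cos th * Rad t =
    Q * (Rad t + 2 * t + (1 - t) * cos th).
    transitivity (((1 - t) * cos th) ^+ 2 + 2 * (1 - t) * cos th * Rad t + Rad t ^+ 2 - 4 * t ^+ 2).
      by rewrite rsq; ring.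
    by rewrite /Q; ring.
  move: (amp t (Rad t)) (conjc _) => A e.
  by congr mx2; rewrite !(rmorphM, rmorphN) /=; field; rewrite ?PC ?QC.
- rewrite /K1 /smooth_K1 /y1 !scale_mx2 expiN ce.
  move: (Num.sqrt (1 - t)) => A.
  by congr mx2; rewrite !(rmorphM, rmorphN) /=; field; rewrite ?sC ?e0.
- rewrite /K2 /smooth_K2 y2E !scale_mx2 expiN QE Den_factor -/P -/Q.
  have -> : (1 - t) ^+ 2 * (1 + cos th ^+ 2) - 2 * (1 - t) * cos th * Rad t =
    P * (Rad t - 2 * t - (1 - t) * cos th).
    transitivity (((1 - t) * cos th) ^+ 2 - 2 * (1 - t) * cos th * Rad t + Rad t ^+ 2 - 4 * t ^+ 2).
      by rewrite rsq; ring.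
    by rewrite /P; ring.
  move: (amp t (- Rad t)) (conjc _) => A e.
  by congr mx2; rewrite !(rmorphM, rmorphN) /=; field; rewrite ?PC ?QC.
Qed.

(** Being affine in cos th and sin th, the entries are continuous, so that the limits defining
    [kraus] at exceptional angles become evaluations. *)
Lemma smooth_kraus_trig (t ph : R) i j k : exists A B D : C,
  forall th, smooth_kraus t th ph i j k = A + (cos th)%:C * B + (sin th)%:C * D.
Proof.
elim/ord3P: i; rewrite /smooth_kraus /= ?/smooth_K0 ?/smooth_K1 ?/smooth_K2.
- set u := (amp _ _)%:C; set e := expi ph; set r := Rad t.
  elim/ord2P: j; elim/ord2P: k.
  + exists 0, 0, (u * (- 'i%C * (1 - t)%:C * conjc e)) => th; rewrite mxE !mx2E; ring.
  + exists (u * ('i%C * (r + 2 * t)%:C)), (u * ('i%C * (1 - t)%:C)), 0 => th; rewrite mxE !mx2E; ring.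
  + exists (- u * ('i%C * (r + 2 * t)%:C)), (u * ('i%C * (1 - t)%:C)), 0 => th; rewrite mxE !mx2E; ring.
  + exists 0, 0, (u * ('i%C * (1 - t)%:C * e)) => th; rewrite mxE !mx2E; ring.
- set u := (_ / 2)%:C; set e := expi ph.
  elim/ord2P: j; elim/ord2P: k.
  + exists (u * (- 'i%C * conjc e)), (u * (- 'i%C * conjc e)), 0 => th; rewrite mxE !mx2E; ring.
  + exists 0, 0, (u * - 'i%C) => th; rewrite mxE !mx2E; ring.
  + exists 0, 0, (u * - 'i%C) => th; rewrite mxE !mx2E; ring.
  + exists (u * (- 'i%C * e)), (u * ('i%C * e)), 0 => th; rewrite mxE !mx2E; ring.
- set u := (amp _ _)%:C; set e := expi ph; set r := Rad t.
  elim/ord2P: j; elim/ord2P: k.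
  + exists 0, 0, (u * ('i%C * (1 - t)%:C * conjc e)) => th; rewrite mxE !mx2E; ring.
  + exists (u * ('i%C * (r - 2 * t)%:C)), (- u * ('i%C * (1 - t)%:C)), 0 => th; rewrite mxE !mx2E; ring.
  + exists (- u * ('i%C * (r - 2 * t)%:C)), (- u * ('i%C * (1 - t)%:C)), 0 => th; rewrite mxE !mx2E; ring.
  + exists 0, 0, (- u * ('i%C * (1 - t)%:C * e)) => th; rewrite mxE !mx2E; ring.
Qed.

Lemma ReD (x y : C) : complex.Re (x + y) = complex.Re x + complex.Re y.
Proof. by case: x y => [? ?] [? ?]. Qed.

Lemma ImD (x y : C) : complex.Im (x + y) = complex.Im x + complex.Im y.
Proof. by case: x y => [? ?] [? ?]. Qed.

Lemma ReZ (r : R) (x : C) : complex.Re (r%:C * x) = r * complex.Re x.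
Proof. by case: x => [? ?]; simpc. Qed.

Lemma ImZ (r : R) (x : C) : complex.Im (r%:C * x) = r * complex.Im x.
Proof. by case: x => [? ?]; simpc. Qed.

Lemma continuous_trig (a b d : R) : continuous (fun x => a + cos x * b + sin x * d).
Proof.
move=> x; apply: cvgD; [apply: cvgD|].
- exact: cvg_cst.
- by apply: cvgM; [exact: continuous_cos|exact: cvg_cst].
- by apply: cvgM; [exact: continuous_sin|exact: cvg_cst].
Qed.

Lemma smooth_kraus_continuous (t ph : R) i j k :
  continuous (fun th => complex.Re (smooth_kraus t th ph i j k)) /\
  continuous (fun th => complex.Im (smooth_kraus t th ph i j k)).
Proof.
have [A [B [D E]]] := smooth_kraus_trig t ph i j k.
split.
- rewrite (_ : (fun th => _) = fun th =>
    complex.Re A + cos th * complex.Re B + sin th * complex.Re D).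
    exact: continuous_trig.
  by apply/funext => th; rewrite E !ReD !ReZ.
- rewrite (_ : (fun th => _) = fun th =>
    complex.Im A + cos th * complex.Im B + sin th * complex.Im D).
    exact: continuous_trig.
  by apply/funext => th; rewrite E !ImD !ImZ.
Qed.

Lemma near_neq0 (f : R -> R) (a d : R) : is_derive a 1 f d ->
  (f a = 0 -> d != 0) -> \forall x \near a^', f x != 0.
Proof.
move=> df; have [fa0 /(_ fa0) d0|fa0 _] := eqVneq (f a) 0.
  exact: isolated_simple_zero df d0 fa0.
have cf : f x @[x --> a] --> f a.
  by apply/differentiable_continuous/derivable1_diffP; case: df.
exact: nbhs_dnbhs (cvgr_neq0 _ cf fa0).
Qed.

Lemma kraus_regular_near (t th : R) : 0 < t < 1 ->
  \forall x \near th^', kraus_regular t x.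
Proof.
move=> t01; have [ra rt] := Rad_gt t01; have /andP[t0 t1] := t01.
have sn : \forall x \near th^', sin x != 0.
  apply: near_neq0 => s0; apply/eqP => c0.
  by have := cos2Dsin2 th; rewrite s0 c0 !expr0n /= addr0 => /esym/eqP; rewrite oner_eq0.
(* Every zero of this factor is simple: the derivative -(1 - t) sin th could vanish only at cos th =
   1 or -1, where a zero would force R < 2t or R = 1 + t, both impossible for 0 < t < 1. *)
have Qn : \forall x \near th^', Rad t - 2 * t + (1 - t) * cos x != 0.
  apply: near_neq0 => Q0; rewrite add0r mul1r scaler_eq0 oppr_eq0 negb_or.
  rewrite subr_eq0 gt_eqF //=; apply/eqP => s0.
  have c1 := cos2Dsin2 th; move: c1; rewrite s0 expr0n /= addr0 => /eqP.
  rewrite sqrf_eq1 => /orP[] /eqP c1; move: Q0; rewrite c1 => Q0; first lra.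
  have := Rad_sq t; have -> : Rad t = 1 + t by lra.
  by rewrite !expr2; nra.
near=> x; apply/and4P; split.
- by near: x.
- rewrite Den_factor mulf_neq0 //; last by near: x.
  by rewrite gt_eqF //; have := cos_le1 x; nra.
- by rewrite lt_eqF //; have := cos_le1 x; nra.
- have -> : (1 - t) * cos x - 2 * t + Rad t = Rad t - 2 * t + (1 - t) * cos x by ring.
  by near: x.
Unshelve. all: by end_near. Qed.

Lemma cvg_kraus_formula (t th ph : R) i j k : 0 < t < 1 ->
  complex.Re (kraus_formula t x ph i j k) @[x --> th^']
    --> complex.Re (smooth_kraus t th ph i j k) /\
  complex.Im (kraus_formula t x ph i j k) @[x --> th^']
    --> complex.Im (smooth_kraus t th ph i j k).
Proof.
move=> t01; have [cR cI] := smooth_kraus_continuous t ph i j k.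
have E : \forall x \near th^', smooth_kraus t x ph i j k = kraus_formula t x ph i j k.
  near=> x; rewrite kraus_formula_regular //; near: x.
  exact: kraus_regular_near.
split.
- have /(cvg_trans (cvg_app _ (@nbhs_dnbhs _ th))) : _ := cR th.
  apply: cvg_trans; apply: near_eq_cvg.
  by near=> x; congr complex.Re; near: x.
- have /(cvg_trans (cvg_app _ (@nbhs_dnbhs _ th))) : _ := cI th.
  apply: cvg_trans; apply: near_eq_cvg.
  by near=> x; congr complex.Im; near: x.
Unshelve. all: by end_near. Qed.

(** With this equality at every angle, neither quotients nor limits occur in the study of the
    class. *)
Lemma krausE (t th ph : R) i : 0 < t < 1 -> kraus t th ph i = smooth_kraus t th ph i.
Proof.
move=> t01; rewrite /kraus; case: ifPn => [reg|_]; first exact: kraus_formula_regular.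
apply/matrixP => j k; rewrite mxE; have [cR cI] := cvg_kraus_formula th ph i j k t01.
rewrite (cvg_lim _ cR) // (cvg_lim _ cI) //.
by case: (smooth_kraus _ _ _ _ _ _).
Qed.
End KrausLimit.

(** * States with scalar correlation matrix and the amplitudes of the Kraus operators *)

Section BlochState.
Variable R : realType.
Local Notation C := R[i].

Lemma entryZ m n (c : C) (A : 'M[C]_(m, n)) i j : (c *: A) i j = c * A i j.
Proof. by rewrite mxE. Qed.

Lemma entryD m n (A B : 'M[C]_(m, n)) i j : (A + B) i j = A i j + B i j.
Proof. by rewrite mxE. Qed.

Lemma entryN m n (A : 'M[C]_(m, n)) i j : (- A) i j = - A i j.
Proof. by rewrite mxE. Qed.

Definition entryE := (entryZ, entryD, entryN).

(** The final state with a free Bloch vector, as the classification meets it before |s| = 1 - t is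
    known; [final_state t th ph] is convertible to the case [svec t th ph]. *)
Definition bloch_state (t : R) (s : nat -> R) : 'M[C]_(2 * 2) :=
  4^-1 *: ((1%:M : 'M[C]_(2 * 2))
    + (1%:M : 'M[C]_2) *t (\sum_(k < 3) (s k.+1)%:C *: pauli R k.+1)
    - t%:C *: \sum_(k < 3) (pauli R k.+1 *t pauli R k.+1)).

Lemma sum3_nat (V : nmodType) (F : nat -> V) :
  \sum_(k < 3) F k = F 0%N + F 1%N + F 2%N.
Proof. by rewrite 3!big_ord_recl big_ord0 addr0 !addrA. Qed.

(** The sum of the products of equal Pauli matrices is 2 SWAP - 1: its diagonal blocks are plus and
    minus sigma_3, its off-diagonal blocks doubled matrix units. *)
Lemma block_bloch_state t (s : nat -> R) a b : block (bloch_state t s) a b =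
  4^-1 *: ((a == b)%:R *: mx2 (1 + (s 3)%:C) ((s 1)%:C - 'i%C * (s 2)%:C)
                              ((s 1)%:C + 'i%C * (s 2)%:C) (1 - (s 3)%:C)
   - t%:C *: (if a == b then (if a == 0 then mx2 1 0 0 (- 1) else mx2 (- 1) 0 0 1)
              else (if a == 0 then mx2 0 0 2 0 else mx2 0 2 0 0))).
Proof.
rewrite /bloch_state blockZ blockD blockD block_tens.
rewrite (sum3_nat (fun k => pauli R k.+1 *t pauli R k.+1)).
rewrite (sum3_nat (fun k => (s k.+1)%:C *: pauli R k.+1)).
rewrite -scaleNr blockZ !blockD !block_tens scaleNr.
have -> : block (1%:M : 'M[C]_(2 * 2)) a b = (a == b)%:R *: 1%:M.
  apply/matrixP => i j; rewrite blockE !mxE (can_eq (@mxtens_indexK 2 2)).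
  by rewrite xpair_eqE -mulnb natrM.
have one : (1%:M : 'M[C]_2) = mx2 1 0 0 1 by rewrite -pauli0E.
rewrite one [mx2 1 0 0 1 a b](_ : _ = (a == b)%:R); last by rewrite -one mxE.
rewrite -scalerDr /pauli.
apply: (f_equal2 (fun X Y : 'M[C]_2 => 4^-1 *: ((a == b)%:R *: X - t%:C *: Y))).
  by rewrite !scale_mx2 !add_mx2; congr mx2; ring.
elim/ord2P: a; elim/ord2P: b; rewrite !mx2E /= !scale_mx2 !add_mx2;
  by congr mx2; rewrite ?(mulrNN, mulNr, mulrN, mulii); ring.
Qed.

(* [mixE] is eps, [mixY] is (n.sigma) eps and [mixM] is the matrix of [K_1]. *)
Definition mixE : 'M[C]_2 := mx2 0 1 (- 1) 0.
Definition mixY (th ph : R) : 'M[C]_2 :=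
  mx2 (- (sin th)%:C * conjc (expi ph)) (cos th)%:C (cos th)%:C ((sin th)%:C * expi ph).
Definition mixM (th ph : R) : 'M[C]_2 :=
  mx2 ((1 + cos th)%:C * conjc (expi ph)) (sin th)%:C (sin th)%:C ((1 - cos th)%:C * expi ph).

Lemma smooth_K0E t th ph : smooth_K0 t th ph =
  ((amp t (Rad t))%:C * 'i%C) *:
    ((Rad t + 2 * t)%:C *: mixE + (1 - t)%:C *: mixY th ph).
Proof. by apply: eq_mx2; rewrite /mixE /mixY /mixM !entryE !mx2E; ring. Qed.

Lemma smooth_K2E t th ph : smooth_K2 t th ph =
  ((amp t (- Rad t))%:C * 'i%C) *:
    ((Rad t - 2 * t)%:C *: mixE - (1 - t)%:C *: mixY th ph).
Proof. by apply: eq_mx2; rewrite /mixE /mixY /mixM !entryE !mx2E; ring. Qed.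

Lemma smooth_K1E t th ph : smooth_K1 t th ph =
  ((Num.sqrt (1 - t) / 2)%:C * - 'i%C) *: mixM th ph.
Proof. by apply: eq_mx2; rewrite /mixE /mixY /mixM !entryE !mx2E; ring. Qed.

Lemma amp_sq (t r : R) : 0 <= 1 + t + r -> 0 <= (1 - t) ^+ 2 + 2 * t * (2 * t + r) ->
  amp t r ^+ 2 = (1 + t + r) / (8 * ((1 - t) ^+ 2 + 2 * t * (2 * t + r))).
Proof.
move=> h1 h2; rewrite /amp expr_div_n sqr_sqrtr ?divr_ge0 // exprMn sqr_sqrtr ?ler0n //.
rewrite -!mulrA -!invfM; congr (_ * _^-1); ring.
Qed.

Lemma Rad_lt (t : R) : 0 < t < 1 -> Rad t < 1 + t.
Proof.
move=> /andP[t0 t1]; have := Rad_sq t; have := Rad_ge0 t; rewrite !expr2 => r0 r2.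
by rewrite ltNge; apply/negP => h; nra.
Qed.

(** The denominators under the roots collapse to R (R + 2t) and R (R - 2t), half the squared norms
    of the coefficient vectors (R + 2t, 1 - t) and (R - 2t, -(1 - t)). *)
Lemma amp_sqE (t : R) (r := Rad t) : 0 < t < 1 ->
  amp t r ^+ 2 = (1 + t + r) / (8 * (r * (r + 2 * t))) /\
  amp t (- r) ^+ 2 = (1 + t - r) / (8 * (r * (r - 2 * t))).
Proof.
move=> t01; have [ra rt] := Rad_gt t01; have rl := Rad_lt t01; have /andP[t0 t1] := t01.
have r2 := Rad_sq t; rewrite -/r in ra rt rl r2.
have e1 : (1 - t) ^+ 2 + 2 * t * (2 * t + r) = r * (r + 2 * t).
  by transitivity (r ^+ 2 + 2 * t * r); [rewrite r2; ring|ring].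
have e2 : (1 - t) ^+ 2 + 2 * t * (2 * t + - r) = r * (r - 2 * t).
  by transitivity (r ^+ 2 - 2 * t * r); [rewrite r2; ring|ring].
by split; rewrite amp_sq ?e1 ?e2 //; nra.
Qed.

(** A spectral decomposition entry by entry: the two rank-one terms of [K0] and [K2] add up to one
    quarter of the matrix with rows (1 + 3t, 1 - t) and (1 - t, 1 - t). The off-diagonal identity is
    stated after division by 1 - t. *)
Lemma amp_identities (t : R) (r := Rad t) : 0 < t < 1 ->
  [/\ (1 - t) * (1 - t) * (amp t r ^+ 2 + amp t (- r) ^+ 2) = (1 - t) / 4,
      amp t r ^+ 2 * (r + 2 * t) - amp t (- r) ^+ 2 * (r - 2 * t) = 1 / 4 &
      amp t r ^+ 2 * (r + 2 * t) ^+ 2 + amp t (- r) ^+ 2 * (r - 2 * t) ^+ 2 = (1 + 3 * t) / 4].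
Proof.
move=> t01; have [ra rt] := Rad_gt t01; have rl := Rad_lt t01; have /andP[t0 t1] := t01.
have r2 := Rad_sq t; have [-> ->] := amp_sqE t01; rewrite -/r in ra rt rl r2 *.
have n1 : r != 0 by rewrite gt_eqF //; lra.
have n2 : r + 2 * t != 0 by rewrite gt_eqF //; lra.
have n3 : r - 2 * t != 0 by rewrite gt_eqF //; lra.
have -> : (1 - t) * (1 - t) = (r + 2 * t) * (r - 2 * t).
  by transitivity (r ^+ 2 - 4 * t ^+ 2); [rewrite r2; ring|ring].
by split; field; rewrite ?n1 ?n2 ?n3.
Qed.

End BlochState.

Section KrausChoi.
Variable R : realType.
Local Notation C := R[i].

Lemma sum3 (V : nmodType) (F : 'I_3 -> V) : \sum_(k < 3) F k = F 0 + F 1 + F 2.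
Proof.
by rewrite 3!big_ord_recl big_ord0 addr0 addrA; congr (F _ + F _ + F _); apply: val_inj.
Qed.

(** The right-hand side no longer contains R or any square root, which leaves only trigonometric
    polynomials to compare in [choi_kraus]. *)
Lemma kraus_mix (t th ph : R) i a j b : 0 < t < 1 ->
  let Y := mixY th ph in let M := mixM th ph in
  \sum_(k < 3) kraus t th ph k i a * conjc (kraus t th ph k j b) =
  4^-1 * ((1 + 3 * t)%:C * (mixE R i a * conjc (mixE R j b))
    + (1 - t)%:C * (mixE R i a * conjc (Y j b) + Y i a * conjc (mixE R j b)
       + Y i a * conjc (Y j b) + M i a * conjc (M j b))).
Proof.
move=> t01 Y M; have [f1 f2 f3] := amp_identities t01.
set r := Rad t in f1 f2 f3.
have hw : ((Num.sqrt (1 - t) / 2)%:C * (Num.sqrt (1 - t) / 2)%:C : C) = 4^-1 * (1 - t)%:C.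
  rewrite -rmorphM mulf_div -expr2 sqr_sqrtr; last by rewrite subr_ge0 ltW //; case/andP: t01.
  by rewrite mulrC rmorphM fmorphV -natrM rmorph_nat.
have q4 : (4^-1)%:C = 4^-1 :> C by rewrite fmorphV rmorph_nat.
have g1 : (1 - t)%:C * (1 - t)%:C * ((amp t r)%:C ^+ 2 + (amp t (- r))%:C ^+ 2) = (1 - t)%:C * 4^-1 :> C.
  by rewrite -q4 -!rmorphXn -!rmorphD -!rmorphM f1.
have g2 : (amp t r)%:C ^+ 2 * (r + 2 * t)%:C - (amp t (- r))%:C ^+ 2 * (r - 2 * t)%:C = 4^-1 :> C.
  by rewrite -q4 -!rmorphXn -!rmorphM -rmorphB f2 mul1r.
have g3 : (amp t r)%:C ^+ 2 * (r + 2 * t)%:C ^+ 2 + (amp t (- r))%:C ^+ 2 * (r - 2 * t)%:C ^+ 2 = (1 + 3 * t)%:C * 4^-1 :> C.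
  by rewrite -q4 -!rmorphXn -!rmorphM -rmorphD f3.
have k0 i' a' : kraus t th ph 0 i' a' = (amp t r)%:C * 'i%C *
    ((r + 2 * t)%:C * mixE R i' a' + (1 - t)%:C * Y i' a').
  by rewrite krausE // [LHS](congr1 (fun A : 'M[C]_2 => A i' a') (smooth_K0E t th ph)) entryZ entryD 2!entryZ.
have k1 i' a' : kraus t th ph 1 i' a' = (Num.sqrt (1 - t) / 2)%:C * - 'i%C * M i' a'.
  by rewrite krausE // [LHS](congr1 (fun A : 'M[C]_2 => A i' a') (smooth_K1E t th ph)) entryZ.
have k2 i' a' : kraus t th ph 2 i' a' = (amp t (- r))%:C * 'i%C *
    ((r - 2 * t)%:C * mixE R i' a' - (1 - t)%:C * Y i' a').
  by rewrite krausE // [LHS](congr1 (fun A : 'M[C]_2 => A i' a') (smooth_K2E t th ph)) entryZ entryD entryN 2!entryZ.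
have cc (p q : R) (x y : C) : conjc (p%:C * 'i%C * (q%:C * x + (1 - t)%:C * y)) =
   p%:C * - 'i%C * (q%:C * conjc x + (1 - t)%:C * conjc y).
  by rewrite conjcM conjcM conjcD (conjcM q%:C) (conjcM (1 - t)%:C) !conjc_real conjc_i.
have cc2 (p q : R) (x y : C) : conjc (p%:C * 'i%C * (q%:C * x - (1 - t)%:C * y)) =
   p%:C * - 'i%C * (q%:C * conjc x - (1 - t)%:C * conjc y).
  by rewrite -(mulrN (1 - t)%:C y) cc conjcN (mulrN (1 - t)%:C).
rewrite [LHS]sum3; move: k0 k1 k2; move: (kraus t th ph) => K k0 k1 k2.
rewrite !k0 !k1 !k2 cc cc2 (conjcM (_ * _)) (conjcM _%:C) conjcN conjc_i opprK conjc_real.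
move: (mixE R i a) (conjc (mixE R j b)) (Y i a) (conjc (Y j b)) (M i a) (conjc (M j b)).
move=> x x' y y' m m'.
move: g1 g2 g3 hw; move: (amp t r)%:C (amp t (- r))%:C (Num.sqrt (1 - t) / 2)%:C => u v w.
move: (r + 2 * t)%:C (r - 2 * t)%:C (1 + 3 * t)%:C (1 - t)%:C => al be k a'.
move=> g1 g2 g3 hw.
transitivity (- ('i%C * 'i%C) * ((u ^+ 2 * al ^+ 2 + v ^+ 2 * be ^+ 2) * (x * x')
   + a' * (u ^+ 2 * al - v ^+ 2 * be) * (x * y' + y * x')
   + (a' * a' * (u ^+ 2 + v ^+ 2)) * (y * y') + (w * w) * (m * m'))).
  ring.
by rewrite g1 g2 g3 hw mulii; ring.
Qed.
End KrausChoi.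

(** * The Choi state of the class and Hilbert-Schmidt products *)

Section KrausChoiState.
Variable R : realType.
Local Notation C := R[i].

Lemma kraus_map_delta m (K : 'I_m -> 'M[C]_2) a b i j :
  kraus_map K (delta_mx a b) i j = \sum_k K k i a * conjc (K k j b).
Proof.
rewrite /kraus_map summxE; apply: eq_bigr => k _.
by rewrite mul_delta_mx_entry adjE.
Qed.

Lemma svec_expi (t th ph : R) :
  ((svec t th ph 1)%:C - 'i%C * (svec t th ph 2)%:C = (1 - t)%:C * (sin th)%:C * conjc (expi ph)) /\
  ((svec t th ph 1)%:C + 'i%C * (svec t th ph 2)%:C = (1 - t)%:C * (sin th)%:C * expi ph).
Proof.
by split; apply/eqP; rewrite eq_complex; apply/andP; split; apply/eqP; rewrite /expi; simpc => /=; ring.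
Qed.

Lemma eq_add_mul0 (x y k z : C) : z = 0 -> x = y + k * z -> x = y.
Proof. by move=> -> ->; rewrite mulr0 addr0. Qed.

Lemma choi_kraus (t th ph : R) : 0 < t < 1 ->
  choi (kraus_map (kraus t th ph)) = final_state t th ph.
Proof.
move=> t01; apply: eq_block => a b; rewrite block_choi.
have -> : block (final_state t th ph) a b = block (bloch_state t (svec t th ph)) a b by [].
rewrite block_bloch_state; have [-> ->] := svec_expi t th ph.
have -> : (svec t th ph 3)%:C = (1 - t)%:C * (cos th)%:C by rewrite /= rmorphM.
have -> : kraus_map (kraus t th ph) (2^-1 *: delta_mx a b) = 2^-1 *: kraus_map (kraus t th ph) (delta_mx a b).
  rewrite /kraus_map scaler_sumr; apply: eq_bigr => k _.
  by rewrite -scalemxAr -scalemxAl.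
have u := expi_unit ph.
have e0 : expi ph != 0.
  by apply/eqP => e; move: u; rewrite e mul0r => /esym/eqP; rewrite oner_eq0.
have ce : conjc (expi ph) = (expi ph)^-1.
  by apply: (mulfI e0); rewrite u divff.
have cs : (sin th)%:C * (sin th)%:C + (cos th)%:C * (cos th)%:C - 1 = 0 :> C.
  rewrite -!rmorphM -rmorphD cos_sin_sq addrNK rmorph1 subrr //.
(* Both sides are expressed through 1 - t, which is then generalised to a single variable. *)
have tE : t%:C = 1 - (1 - t)%:C :> C by rewrite rmorphB rmorph1; ring.
have t3 : (1 + 3 * t)%:C = 4 - 3 * (1 - t)%:C :> C.
  by rewrite rmorphB rmorphD rmorphM rmorph1 rmorph_nat; ring.
apply/matrixP => i j.
have entries : (2^-1 *: kraus_map (kraus t th ph) (delta_mx a b)) i j =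
    2^-1 * \sum_k kraus t th ph k i a * conjc (kraus t th ph k j b).
  by rewrite entryZ kraus_map_delta.
rewrite entries kraus_mix // t3 tE /mixE /mixY /mixM.
rewrite entryZ entryD entryN 2!entryZ.
have -> : (1 + cos th)%:C = 1 + (cos th)%:C :> C by rewrite rmorphD rmorph1.
have -> : (1 - cos th)%:C = 1 - (cos th)%:C :> C by rewrite rmorphB rmorph1.
move: cs e0 ce (conjcK (expi ph)); move: (sin th)%:C (conjc_real (sin th)) (cos th)%:C
  (conjc_real (cos th)) (1 - t)%:C (expi ph) => s hs c hc k e cs e0 ce cK.
have ce' : conjc (e^-1) = e by rewrite -ce.
clear -hs hc cs e0 ce ce'.
(* Each entry is an identity modulo sin^2 + cos^2 = 1; the values of [k] are the
   cofactors that occur. *)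
elim/ord2P: a; elim/ord2P: b; rewrite ?eqxx /=;
  elim/ord2P: i; elim/ord2P: j; rewrite !mx2E;
  rewrite ?(conjcM, conjcD, conjcN, conjc0, conjc1, ce', ce, hs, hc);
  first [ by field; rewrite ?e0
        | by apply: (eq_add_mul0 (k := 8^-1 * k) cs); field; rewrite ?e0
        | by apply: (eq_add_mul0 (k := - (8^-1 * k) * e ^- 2) cs); field; rewrite ?e0
        | by apply: (eq_add_mul0 (k := - (8^-1 * k) * e ^+ 2) cs); field; rewrite ?e0 ].
Qed.

Lemma hsE (A B : 'M[C]_2) : \tr (A ^t* *m B) =
  conjc (A 0 0) * B 0 0 + conjc (A 0 1) * B 0 1 + conjc (A 1 0) * B 1 0 + conjc (A 1 1) * B 1 1.
Proof. rewrite tr2 !mul2E !adjE; ring. Qed.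

Lemma hsZ (c d : C) (A B : 'M[C]_2) : \tr ((c *: A) ^t* *m (d *: B)) = conjc c * d * \tr (A ^t* *m B).
Proof. rewrite !hsE !entryZ !conjcM; ring. Qed.

Lemma hs_comb (p q p' q' : R) (A B : 'M[C]_2) :
  \tr ((p%:C *: A + q%:C *: B) ^t* *m (p'%:C *: A + q'%:C *: B)) =
  (p * p')%:C * \tr (A ^t* *m A) + (p * q')%:C * \tr (A ^t* *m B)
  + (q * p')%:C * \tr (B ^t* *m A) + (q * q')%:C * \tr (B ^t* *m B).
Proof.
have eE (u v : R) k l : (u%:C *: A + v%:C *: B) k l = u%:C * A k l + v%:C * B k l.
  by rewrite entryD !entryZ.
have cE (u v : R) k l : conjc ((u%:C *: A + v%:C *: B) k l)
    = u%:C * conjc (A k l) + v%:C * conjc (B k l).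
  by rewrite eE conjcD 2!conjcM !conjc_real.
rewrite !hsE !cE !eE; ring.
Qed.

Lemma hs_conj (A B : 'M[C]_2) : \tr (A ^t* *m B) = conjc (\tr (B ^t* *m A)).
Proof.
rewrite [in RHS]hsE 3!conjcD (conjcM (conjc (B 0 0))) (conjcM (conjc (B 0 1))).
rewrite (conjcM (conjc (B 1 0))) (conjcM (conjc (B 1 1))) !conjcK hsE; ring.
Qed.

(** Read as two-qubit vectors, E is the singlet, and Y and M are the triplet states of spin 0 and
    spin 1 along n, which are mutually orthogonal; M is a product vector. *)
Lemma mix_gram (th ph : R) (E := mixE R) (Y := mixY th ph) (M := mixM th ph) :
  ((\tr (E ^t* *m E) = 2) * (\tr (Y ^t* *m Y) = 2) * (\tr (M ^t* *m M) = 4) *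
   (\tr (E ^t* *m Y) = 0) * (\tr (E ^t* *m M) = 0) * (\tr (Y ^t* *m M) = 0))%type.
Proof.
have u := expi_unit ph.
have cs : (sin th)%:C * (sin th)%:C = 1 - (cos th)%:C * (cos th)%:C :> C.
  by rewrite -!rmorphM cos_sin_sq rmorphB rmorph1.
have c1 : (1 + cos th)%:C = 1 + (cos th)%:C :> C by rewrite rmorphD rmorph1.
have c2 : (1 - cos th)%:C = 1 - (cos th)%:C :> C by rewrite rmorphB rmorph1.
rewrite !hsE /E /Y /M /mixE /mixY /mixM !mx2E.
rewrite !(conjcM, conjcN, conjcK, conjc_real, conjc0, conjc1) c1 c2.
move: u cs; move: (sin th)%:C (cos th)%:C (expi ph) (conjc (expi ph)) => s c e e' u cs.
do !split.
- ring.
- transitivity ((e * e') * (2 * (s * s)) + 2 * (c * c)); first ring.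
  by rewrite u cs; ring.
- transitivity ((e * e') * (2 + 2 * (c * c)) + 2 * (s * s)); first ring.
  by rewrite u cs; ring.
- ring.
- ring.
- transitivity ((1 - e * e') * (2 * (s * c))); first ring.
  by rewrite u; ring.
Qed.

Lemma kraus_forms (t th ph : R) (K := kraus t th ph) : 0 < t < 1 ->
  [/\ K 0 = ((amp t (Rad t))%:C * 'i%C) *:
        ((Rad t + 2 * t)%:C *: mixE R + (1 - t)%:C *: mixY th ph),
      K 1 = ((Num.sqrt (1 - t) / 2)%:C * - 'i%C) *: mixM th ph &
      K 2 = ((amp t (- Rad t))%:C * 'i%C) *:
        ((Rad t - 2 * t)%:C *: mixE R + (- (1 - t))%:C *: mixY th ph)].
Proof.
move=> t01; rewrite /K !krausE // -smooth_K0E -smooth_K1E rmorphN scaleNr.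
by split => //; exact: smooth_K2E.
Qed.

Lemma hs_combM (p q : R) (A B M : 'M[C]_2) : \tr ((p%:C *: A + q%:C *: B) ^t* *m M) =
  p%:C * \tr (A ^t* *m M) + q%:C * \tr (B ^t* *m M).
Proof.
have cE k l : conjc ((p%:C *: A + q%:C *: B) k l)
    = p%:C * conjc (A k l) + q%:C * conjc (B k l).
  by rewrite entryD !entryZ conjcD 2!conjcM !conjc_real.
rewrite !hsE !cE; ring.
Qed.

End KrausChoiState.

(** * Orthogonality of the Kraus operators and rank of the Choi state *)

Section KrausGram.
Variable R : realType.
Local Notation C := R[i].

Lemma symm_offdiag (h : 'I_3 -> 'I_3 -> C) i j :
  (forall i j, h i j = conjc (h j i)) -> h 0 1 = 0 -> h 0 2 = 0 -> h 2 1 = 0 ->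
  i != j -> h i j = 0.
Proof.
move=> hc h01 h02 h21; elim/ord3P: i; elim/ord3P: j.
- by [].
- by rewrite h01.
- by rewrite h02.
- by rewrite hc h01 conjc0.
- by [].
- by rewrite hc h21 conjc0.
- by rewrite hc h02 conjc0.
- by rewrite h21.
- by [].
Qed.

(** For [K 0] and [K 2] this is (R + 2t)(R - 2t) = (1 - t)^2, as E and Y have equal norm; [K 1] is a
    multiple of M, which is orthogonal to E and Y. *)
Lemma kraus_orthogonal (t th ph : R) (K := kraus t th ph) i j : 0 < t < 1 ->
  i != j -> \tr ((K i) ^t* *m K j) = 0.
Proof.
move=> t01 ij; have [k0 k1 k2] := kraus_forms th ph t01; rewrite -/K in k0 k1 k2.
have g := mix_gram th ph.
have g' : \tr ((mixY th ph) ^t* *m mixE R) = 0 by rewrite hs_conj g conjc0.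
have h01 : \tr ((K 0) ^t* *m K 1) = 0.
  by rewrite k0 k1 hsZ hs_combM !g !mulr0 addr0 mulr0.
have h21 : \tr ((K 2) ^t* *m K 1) = 0.
  by rewrite k2 k1 hsZ hs_combM !g !mulr0 addr0 mulr0.
have h02 : \tr ((K 0) ^t* *m K 2) = 0.
  rewrite k0 k2 hsZ hs_comb g' !g !mulr0 !addr0.
  rewrite (_ : (1 - t) * - (1 - t) = - ((Rad t + 2 * t) * (Rad t - 2 * t))).
    by rewrite rmorphN mulNr subrr mulr0.
  by have := Rad_sq t; rewrite !expr2 => h; rewrite mulrN; congr (- _); lra.
exact: (symm_offdiag (h := fun i j => \tr ((K i) ^t* *m K j)) (fun i j => hs_conj _ _) h01 h02 h21 ij).
Qed.

(** The delicate factors are sqrt(1 - t) in [K 1] and 1 + t - R in [K 2]; the latter is positive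
    because R < 1 + t. These are the nonzero eigenvalues behind rank three. *)
Lemma kraus_norm_neq0 (t th ph : R) (K := kraus t th ph) i : 0 < t < 1 ->
  \tr ((K i) ^t* *m K i) != 0.
Proof.
move=> t01; have := kraus_forms th ph t01; rewrite -/K; clearbody K => -[k0 k1 k2].
have [ra rt] := Rad_gt t01; have rl := Rad_lt t01; have /andP[t0 t1] := t01.
have [a0 a2] := amp_sqE t01.
have r2 := Rad_sq t.
have g := mix_gram th ph.
have g' : \tr ((mixY th ph) ^t* *m mixE R) = 0 by rewrite hs_conj g conjc0.
have amp0 : amp t (Rad t) != 0.
  rewrite -sqrf_eq0 a0 mulf_neq0 ?invr_neq0 // gt_eqF //; nra.
have amp2 : amp t (- Rad t) != 0.
  rewrite -sqrf_eq0 a2 mulf_neq0 ?invr_neq0 // gt_eqF //; nra.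
have i0 : 'i%C != 0 :> C by rewrite eq_complex /= oner_eq0 andbF.
have nz (p : R) (z : C) : p != 0 -> z != 0 -> conjc (p%:C * z) * (p%:C * z) != 0.
  by move=> p0 z0; rewrite mulf_neq0 // ?conjc_eq0 mulf_neq0 // fmorph_eq0.
have pos (p q : R) : 0 < p -> (p * p)%:C * 2 + (q * q)%:C * 2 != 0 :> C.
  move=> p0; rewrite -mulrDl mulf_neq0 ?pnatr_eq0 // -rmorphD fmorph_eq0 gt_eqF //.
  by nra.
elim/ord3P: i.
- rewrite k0 hsZ hs_comb g' !g !mulr0 !addr0 mulf_neq0 ?nz // pos //; lra.
- rewrite k1 hsZ g mulf_neq0 ?pnatr_eq0 ?nz ?oppr_eq0 //.
  by rewrite mulf_neq0 ?invr_neq0 ?pnatr_eq0 // sqrtr_eq0 -ltNge subr_gt0.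
- rewrite k2 hsZ hs_comb g' !g !mulr0 !addr0 mulf_neq0 ?nz // pos //; lra.
Qed.

Lemma rank_rowgram m n (A : 'M[C]_(m, n)) (d : 'rV[C]_m) :
  A *m A ^t* = diag_mx d -> (forall i, d 0 i != 0) -> \rank (A ^t* *m A) = m.
Proof.
move=> AA d0; have du : diag_mx d \in unitmx.
  by rewrite unitmxE det_diag unitfE; apply/prodf_neq0 => i _.
have r : \rank (A *m (A ^t* *m A) *m A ^t*) = m.
  rewrite !mulmxA AA -mulmxA AA; apply: mxrank_unit.
  by rewrite unitmx_mul du.
apply/eqP; rewrite eqn_leq; apply/andP; split.
  by rewrite (leq_trans (mxrankM_maxr _ _)) // rank_leq_row.
rewrite -{1}r (leq_trans (mxrankM_maxl _ _)) //; exact: mxrankM_maxr.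
Qed.

Lemma rank_choi_kraus (t th ph : R) : 0 < t < 1 ->
  \rank (choi (kraus_map (kraus t th ph))) = 3%N.
Proof.
move=> t01; set K := kraus t th ph.
(* The rows are the conjugated Kraus operators written as vectors: A^* A is twice the Choi state,
   and A A^* is diagonal by orthogonality. *)
pose A : 'M[C]_(3, 2 * 2) :=
  \matrix_(k, x) conjc (K k (mxtens_unindex x).2 (mxtens_unindex x).1).
have AE k (a i : 'I_2) : A k (mxtens_index (a, i)) = conjc (K k i a).
  by rewrite mxE mxtens_indexK.
have -> : choi (kraus_map K) = 2^-1 *: (A ^t* *m A).
  apply: eq_block => a b; rewrite block_choi blockZ.
  have -> : kraus_map K (2^-1 *: delta_mx a b) = 2^-1 *: kraus_map K (delta_mx a b).
    rewrite /kraus_map scaler_sumr; apply: eq_bigr => k _.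
    by rewrite -scalemxAr -scalemxAl.
  congr (_ *: _); apply/matrixP => i j; rewrite kraus_map_delta blockE mxE.
  by apply: eq_bigr => k _; rewrite adjE !AE conjcK.
rewrite mxrank_scale_nz ?invr_neq0 ?pnatr_eq0 //.
apply: (@rank_rowgram _ _ A (\row_k \tr ((K k) ^t* *m K k))) => [|i]; last first.
  by rewrite mxE; exact: kraus_norm_neq0.
apply/matrixP => k l; rewrite mxE sum_mxtens !sum2 !adjE !AE !conjcK mxE mxE.
have [->|kl] := eqVneq k l; first by rewrite mulr1n hsE; ring.
rewrite mulr0n; have := kraus_orthogonal th ph t01 kl; rewrite -/K hsE => <-; ring.
Qed.
End KrausGram.

(** * Correlation matrices and local unitaries *)

Lemma conj_mulmx (F : pzRingType) n (U W A B : 'M[F]_n) : U *m W = 1%:M ->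
  (W *m A *m U) *m (W *m B *m U) = W *m (A *m B) *m U.
Proof. by move=> UW; rewrite !mulmxA -(mulmxA (W *m A)) UW mulmx1. Qed.

Lemma tr_conj_mulmx (F : comPzRingType) n (A B D P : 'M[F]_n) :
  \tr (A *m B *m D *m P) = \tr (B *m (D *m P *m A)).
Proof. by rewrite -!mulmxA mxtrace_mulC !mulmxA. Qed.

Lemma mul_gram (F : comPzRingType) n (A T B : 'M[F]_n) : B^T *m B = 1%:M ->
  A *m T *m B^T *m (A *m T *m B^T)^T = A *m (T *m T^T) *m A^T.
Proof.
by move=> h; rewrite !trmx_mul trmxK !mulmxA -(mulmxA (A *m T)) h mulmx1.
Qed.

Section PauliTraces.
Variable R : realType.
Local Notation C := R[i].

Lemma Re_sum I (r : seq I) (F : I -> C) :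
  complex.Re (\sum_(i <- r) F i) = \sum_(i <- r) complex.Re (F i).
Proof.
elim: r => [|x r IH]; first by rewrite !big_nil.
by rewrite !big_cons ReD IH.
Qed.

Lemma tr_sum I (r : seq I) n (F : I -> 'M[C]_n) :
  \tr (\sum_(i <- r) F i) = \sum_(i <- r) \tr (F i).
Proof. exact: raddf_sum. Qed.

Lemma tr_tens m n (A : 'M[C]_m) (B : 'M[C]_n) : \tr (A *t B) = \tr A * \tr B.
Proof.
rewrite /mxtrace sum_mxtens mulr_suml; apply: eq_bigr => i _.
by rewrite mulr_sumr; apply: eq_bigr => j _; rewrite tensmxE.
Qed.

Lemma tr_mx2 (a b c d : C) : \tr (mx2 a b c d) = a + d.
Proof. by rewrite tr2 !mx2E. Qed.

Lemma tr_pauli (k : 'I_3) : \tr (pauli R k.+1) = 0.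
Proof. by elim/ord3P: k; rewrite tr_mx2; ring. Qed.

Lemma tr_pauli_mul (k l : 'I_3) :
  \tr (pauli R k.+1 *m pauli R l.+1) = 2 * (k == l)%:R.
Proof.
by elim/ord3P: k; elim/ord3P: l; rewrite /pauli mul_mx2 tr_mx2 /eq_op /=
  ?(mulrNN, mulNr, mulrN) ?mulii; ring.
Qed.

Lemma adj_pauli (k : 'I_3) : (pauli R k.+1) ^t* = pauli R k.+1.
Proof.
by elim/ord3P: k; rewrite /pauli adj_mx2 ?conjcN ?conjc_i ?conjc0 ?conjc1 ?opprK.
Qed.

Lemma pauli_expand (B : 'M[C]_2) : \tr B = 0 -> B ^t* = B ->
  B = \sum_(j < 3) (complex.Re (2^-1 * \tr (B *m pauli R j.+1)))%:C *: pauli R j.+1.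
Proof.
move=> tB hB.
have e00 := congr1 (fun M : 'M[C]_2 => M 0 0) hB.
have e01 := congr1 (fun M : 'M[C]_2 => M 0 1) hB.
move: tB e00 e01; rewrite tr2 !adjE.
rewrite sum3 /= !tr2 !mul2E !mx2E.
have h : 2^-1 = (2^-1)%:C :> C by rewrite fmorphV rmorph_nat.
rewrite h.
have [x [y [z [w E]]]] : exists x y z w, B = mx2 x y z w.
  by exists (B 0 0), (B 0 1), (B 1 0), (B 1 1); apply: eq_mx2; rewrite !mx2E.
rewrite E !mx2E {E hB}.
case: x y z w => [x x'] [y y'] [z z'] [w w'] [] + + [] + [] + +.
move=> h1 h2 h3 h4 h5.
rewrite !scale_mx2 !add_mx2; simpc.
by congr mx2; apply/eqP; rewrite eq_complex; apply/andP; split; apply/eqP => /=; lra.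
Qed.

Lemma unitary_mulV n (U : 'M[C]_n) : U \is unitarymx -> U *m U ^t* = 1%:M.
Proof. by move/unitarymxP. Qed.

Lemma unitary_Vmul n (U : 'M[C]_n) : U \is unitarymx -> U ^t* *m U = 1%:M.
Proof. by move=> /unitary_mulV; exact: mulmx1C. Qed.

(** The adjoint action of U on traceless matrices, in the Pauli basis. *)
Definition rot (U : 'M[C]_2) : 'M[R]_3 := \matrix_(i, j)
  complex.Re (2^-1 * \tr (U ^t* *m pauli R i.+1 *m U *m pauli R j.+1)).

Lemma rotE (U : 'M[C]_2) (i : 'I_3) : U \is unitarymx ->
  U ^t* *m pauli R i.+1 *m U = \sum_(j < 3) (rot U i j)%:C *: pauli R j.+1.
Proof.
move=> uU; rewrite {1}[LHS]pauli_expand.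
- by apply: eq_bigr => j _; rewrite mxE.
- by rewrite mxtrace_mulC mulmxA (unitary_mulV uU) mul1mx tr_pauli.
- by rewrite !adj_mul adjK adj_pauli mulmxA.
Qed.

(** Conjugation by a unitary preserves the form tr(A B), for which the Pauli matrices are orthogonal
    with square norm 2. *)
Lemma rot_orthogonal (U : 'M[C]_2) : U \is unitarymx -> rot U *m (rot U)^T = 1%:M.
Proof.
move=> uU; apply/matrixP => i j.
have : \tr ((U ^t* *m pauli R i.+1 *m U) *m (U ^t* *m pauli R j.+1 *m U)) = 2 * (i == j)%:R.
  have -> : (U ^t* *m pauli R i.+1 *m U) *m (U ^t* *m pauli R j.+1 *m U)
      = U ^t* *m (pauli R i.+1 *m pauli R j.+1) *m U.
    exact/conj_mulmx/unitary_mulV.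
  by rewrite mxtrace_mulC mulmxA unitary_mulV // mul1mx tr_pauli_mul.
rewrite !rotE // mulmx_suml linear_sum /=.
under eq_bigr => k _.
  rewrite mulmx_sumr linear_sum /=.
  under eq_bigr => l _ do rewrite -scalemxAl -scalemxAr !linearZ /= tr_pauli_mul mulrA.
  rewrite (bigD1 k) //= eqxx big1 ?addr0 => [|l lk]; last first.
    by rewrite eq_sym (negPf lk) !mulr0.
  over.
rewrite mxE [(1%:M : 'M[R]_3) i j]mxE /= => h.
have : (2 * \sum_k rot U i k * rot U j k)%:C = (2 * (i == j)%:R)%:C :> C.
  rewrite rmorphM rmorph_sum mulr_sumr /= rmorphM !rmorph_nat -h.
  by apply: eq_bigr => k _; rewrite rmorphM /=; ring.
move=> /complexI /mulfI h2; rewrite -h2 ?pnatr_eq0 //.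
by apply: eq_bigr => k _; rewrite [_^T _ _]mxE.
Qed.

Lemma rot_orthogonal' (U : 'M[C]_2) : U \is unitarymx -> (rot U)^T *m rot U = 1%:M.
Proof. by move=> uU; apply: mulmx1C; exact: rot_orthogonal. Qed.

(** Cyclicity of the trace moves the unitaries onto the Pauli matrices, where they act through
    [rot]. *)
Lemma correlation_local_unitary (U V : 'M[C]_2) (rho : 'M[C]_(2 * 2)) :
  U \is unitarymx -> V \is unitarymx ->
  correlation (local_unitary U V rho) = rot U *m correlation rho *m (rot V)^T.
Proof.
move=> uU uV; apply/matrixP => i j; rewrite mxE.
have -> : \tr (local_unitary U V rho *m (pauli R i.+1 *t pauli R j.+1)) =
   \tr (rho *m ((U ^t* *m pauli R i.+1 *m U) *t (V ^t* *m pauli R j.+1 *m V))).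
  by rewrite /local_unitary tr_conj_mulmx adj_tens !tensmx_mul.
rewrite !rotE //.
have tens_sum (c d : 'I_3 -> C) :
    (\sum_k c k *: pauli R k.+1) *t (\sum_l d l *: pauli R l.+1)
    = \sum_k \sum_l (c k * d l) *: (pauli R k.+1 *t pauli R l.+1).
  apply: eq_block => a b; rewrite block_tens block_sum summxE scaler_suml.
  apply: eq_bigr => k _; rewrite block_sum scaler_sumr; apply: eq_bigr => l _.
  by rewrite blockZ block_tens entryZ !scalerA mulrAC.
rewrite tens_sum mulmx_sumr tr_sum [RHS]mxE.
rewrite Re_sum.
under [RHS]eq_bigr => l _ do rewrite mxE mulr_suml.
rewrite [RHS]exchange_big /=; apply: eq_bigr => k _.
rewrite mulmx_sumr tr_sum Re_sum.
apply: eq_bigr => l _.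
rewrite -scalemxAr mxtraceZ -rmorphM ReZ.
rewrite [(rot V)^T _ _]mxE [correlation rho k l]mxE; ring.
Qed.

(** Unlike T = -t 1, this condition survives multiplication of T by orthogonal matrices on both
    sides, so it passes between a state and all its local rotations. *)
Definition scaled_orthogonal (t : R) (T : 'M[R]_3) : Prop :=
  T *m T^T = (t ^+ 2)%:M.

Lemma scaled_orthogonal_local_unitary (t : R) (U V : 'M[C]_2) (rho : 'M[C]_(2 * 2)) :
  U \is unitarymx -> V \is unitarymx ->
  scaled_orthogonal t (correlation (local_unitary U V rho)) <->
  scaled_orthogonal t (correlation rho).
Proof.
move=> uU uV; rewrite /scaled_orthogonal correlation_local_unitary //.
set T := correlation rho.
have -> : rot U *m T *m (rot V)^T *m (rot U *m T *m (rot V)^T)^T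
    = rot U *m (T *m T^T) *m (rot U)^T.
  exact/mul_gram/rot_orthogonal'.
split=> h; last by rewrite h mul_mx_scalar -scalemxAl rot_orthogonal // scalemx1.
have : (rot U)^T *m (rot U *m (T *m T^T) *m (rot U)^T) *m rot U = T *m T^T.
  by rewrite -!mulmxA (rot_orthogonal' uU) mulmx1 !mulmxA (rot_orthogonal' uU) mul1mx.
by rewrite h mul_mx_scalar -scalemxAl (rot_orthogonal' uU) scalemx1.
Qed.

(** Each row of T has norm t, which bounds its diagonal entry. *)
Lemma scaled_orthogonal_entry (t : R) (T : 'M[R]_3) k :
  0 <= t -> scaled_orthogonal t T -> `|T k k| <= t.
Proof.
move=> t0 /(congr1 (fun M : 'M[R]_3 => M k k)).
rewrite mxE [RHS]mxE eqxx mulr1n (bigD1 k) //= [_^T _ _]mxE -expr2 => h.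
rewrite -(@ler_pXn2r _ 2) ?nnegrE // -h real_normK ?num_real // lerDl.
by apply: sumr_ge0 => j _; rewrite [_^T _ _]mxE -expr2 sqr_ge0.
Qed.

Lemma scaled_orthogonal_scalar (d : R) : scaled_orthogonal d (- d)%:M.
Proof. by rewrite /scaled_orthogonal tr_scalar_mx -scalar_mxM mulrNN expr2. Qed.

(** A 2-by-2 matrix is determined by its four Pauli traces. This is applied once per tensor factor:
    to the matrix [tau] of block traces against a fixed Pauli matrix, then to each block. *)
Lemma eq_pauli_tr (X Y : 'M[C]_(2 * 2)) :
  (forall k l : 'I_4, \tr (X *m (pauli R k *t pauli R l)) =
     \tr (Y *m (pauli R k *t pauli R l))) -> X = Y.
Proof.
have sep (A B : 'M[C]_2) : (forall k : 'I_4, \tr (A *m pauli R k) = \tr (B *m pauli R k)) -> A = B.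
  move=> h; have := h 0; have := h 1; have := h 2; have := h 3.
  have one : (1%:M : 'M[C]_2) = mx2 1 0 0 1 by rewrite -pauli0E.
  rewrite /= one !tr2 !mul2E !mx2E => h3 h2 h1 h0.
  have d1 : A 0 1 - A 1 0 = B 0 1 - B 1 0.
    have i0 : 'i%C != 0 :> C by rewrite eq_complex /= oner_eq0 andbF.
    apply: (mulfI i0); transitivity (A 0 0 * 0 + A 0 1 * 'i%C + (A 1 0 * - 'i%C + A 1 1 * 0)); first ring.
    rewrite h2; ring.
  have two : 2 != 0 :> C by rewrite pnatr_eq0.
  apply: eq_mx2; apply: (mulfI two).
  - transitivity ((A 0 0 * 1 + A 0 1 * 0 + (A 1 0 * 0 + A 1 1 * 1))
      + (A 0 0 * 1 + A 0 1 * 0 + (A 1 0 * 0 + A 1 1 * -1))); first ring.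
    by rewrite h0 h3; ring.
  - transitivity ((A 0 0 * 0 + A 0 1 * 1 + (A 1 0 * 1 + A 1 1 * 0)) + (A 0 1 - A 1 0)); first ring.
    by rewrite h1 d1; ring.
  - transitivity ((A 0 0 * 0 + A 0 1 * 1 + (A 1 0 * 1 + A 1 1 * 0)) - (A 0 1 - A 1 0)); first ring.
    by rewrite h1 d1; ring.
  - transitivity ((A 0 0 * 1 + A 0 1 * 0 + (A 1 0 * 0 + A 1 1 * 1))
      - (A 0 0 * 1 + A 0 1 * 0 + (A 1 0 * 0 + A 1 1 * -1))); first ring.
    by rewrite h0 h3; ring.
move=> h; apply: eq_block => a b; apply: (sep _ _) => l.
pose tau (Z : 'M[C]_(2 * 2)) : 'M[C]_2 := \matrix_(a, b) \tr (block Z a b *m pauli R l).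
have E : tau X = tau Y.
  apply: (sep _ _) => k; have := h k l; rewrite !tr_mul_tens /tau.
  have aux Z : \sum_a \sum_b pauli R k b a * \tr (block Z a b *m pauli R l)
      = \tr ((\matrix_(a, b) \tr (block Z a b *m pauli R l)) *m pauli R k).
    rewrite /mxtrace; apply: eq_bigr => a' _; rewrite mxE; apply: eq_bigr => b' _.
    by rewrite mxE mulrC.
  by rewrite !aux.
by have := congr1 (fun M : 'M[C]_2 => M a b) E; rewrite !mxE.
Qed.

Lemma tr_bloch_state (t : R) (s : nat -> R) (A B : 'M[C]_2) :
  \tr (bloch_state t s *m (A *t B)) = 4^-1 * (\tr A * \tr B
    + \tr A * (\sum_(k < 3) (s k.+1)%:C * \tr (pauli R k.+1 *m B))
    - t%:C * \sum_(k < 3) \tr (pauli R k.+1 *m A) * \tr (pauli R k.+1 *m B)).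
Proof.
rewrite /bloch_state -scalemxAl mxtraceZ mulmxBl mulmxDl raddfB /= mxtraceD mul1mx.
rewrite tr_tens tensmx_mul mul1mx tr_tens mulmx_suml tr_sum.
rewrite -scalemxAl mxtraceZ mulmx_suml tr_sum.
congr (_ * (_ + _ * _ - _ * _)); apply: eq_bigr => k _.
  by rewrite -scalemxAl mxtraceZ.
by rewrite tensmx_mul tr_tens.
Qed.

Lemma correlation_bloch_state (t : R) (s : nat -> R) :
  correlation (bloch_state t s) = (- t)%:M.
Proof.
apply/matrixP => i j; rewrite [LHS]mxE [RHS]mxE tr_bloch_state tr_pauli !mul0r !add0r.
rewrite (bigD1 i) //= big1 ?addr0 => [|k ki]; last first.
  by rewrite tr_pauli_mul (negPf ki) mulr0 mul0r.
rewrite !tr_pauli_mul eqxx.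
have -> : 4^-1 * - (t%:C * (2 * 1%:R * (2 * (i == j)%:R))) = (- (t *+ (i == j)))%:C :> C.
  by case: (i == j); rewrite /= ?mulr0n ?oppr0 ?rmorph0 ?mulr1n ?rmorphN; field.
by rewrite /= mulNrn.
Qed.
End PauliTraces.

(** * Usefulness for universal teleportation *)

Section Usefulness.
Variable R : realType.
Local Notation C := R[i].
Implicit Types (U V : 'M[C]_2) (rho : 'M[C]_(2 * 2)) (t : R).

Lemma tens_one : (1%:M : 'M[C]_2) *t (1%:M : 'M[C]_2) = 1%:M.
Proof.
apply: eq_block => a b; rewrite block_tens; apply/matrixP => i j.
rewrite blockE !mxE (can_eq (@mxtens_indexK 2 2)) xpair_eqE.
by rewrite -mulnb natrM.
Qed.

Lemma tens_unitary_Vmul U V : U \is unitarymx -> V \is unitarymx ->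
  (U *t V) ^t* *m (U *t V) = 1%:M.
Proof.
by move=> uU uV; rewrite adj_tens tensmx_mul !unitary_Vmul // tens_one.
Qed.

Lemma tr_local_unitary U V rho : U \is unitarymx -> V \is unitarymx ->
  \tr (local_unitary U V rho) = \tr rho.
Proof.
move=> uU uV; rewrite /local_unitary mxtrace_mulC mulmxA.
by rewrite tens_unitary_Vmul // mul1mx.
Qed.

(** The average is (1 - tr T / 3) / 2, and every diagonal entry of a rotated T stays at least -t.
    This bounds the supremum in [max_average_fidelity]. *)
Lemma average_fidelity_le t U V rho : 0 <= t -> complex.Re (\tr rho) = 1 ->
  scaled_orthogonal t (correlation rho) ->
  U \is unitarymx -> V \is unitarymx ->
  average_fidelity (local_unitary U V rho) <= (1 + t) / 2.
Proof.
move=> t0 tr1 so uU uV; rewrite average_fidelityE tr_local_unitary // tr1.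
have /(scaled_orthogonal_local_unitary _ _ uU uV) := so.
set T := correlation _ => soT.
have b k : - t <= T k k.
  by have := scaled_orthogonal_entry k t0 soT; rewrite ler_norml => /andP[].
have := b 0; have := b 1; have := b 2.
rewrite /mxtrace sum3; lra.
Qed.

Lemma one_unitary : (1%:M : 'M[C]_2) \is unitarymx.
Proof.
by apply/unitarymxP; rewrite mul1mx; apply/matrixP => i j; rewrite adjE !mxE conjc_nat eq_sym.
Qed.

Lemma local_unitary1 rho : local_unitary 1%:M 1%:M rho = rho.
Proof.
rewrite /local_unitary tens_one mul1mx.
rewrite (_ : 1%:M ^t* = 1%:M) ?mulmx1 //.
by apply/matrixP => i j; rewrite adjE !mxE conjc_nat eq_sym.
Qed.

Lemma diag_entries (T : 'M[R]_3) (d : R) : is_diag_mx T ->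
  (forall k, T k k = d) -> T = d%:M.
Proof.
move=> /is_diag_mxP dT hd; apply/matrixP => i j; rewrite [RHS]mxE.
have [->|ij] := eqVneq i j; first by rewrite mulr1n.
by rewrite mulr0n dT.
Qed.

(** If d > 0 the determinant d^3 is positive, and a canonical form would then have only one positive
    entry. *)
Lemma canonical_equal_neg rho d : is_canonical rho ->
  correlation rho = d%:M -> d <= 0.
Proof.
move=> [_ _ pos] E; rewrite leNgt; apply/negP => d0.
have : 0 < \det (correlation rho) by rewrite E det_scalar exprn_gt0.
move=> /pos [k [_ /(_ (if k == 0 then 1 else 0))]].
have ne : (if k == 0 then 1 else 0) != k by elim/ord3P: k.
by move=> /(_ ne) []; rewrite E mxE eqxx mulr1n ltNge (ltW d0).
Qed.

Lemma useful_UQT_correlation rho : complex.Re (\tr rho) = 1 -> useful_UQT rho ->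
  exists U V t, [/\ U \is unitarymx, V \is unitarymx, 1 / 3 < t,
    is_canonical (local_unitary U V rho) &
    correlation (local_unitary U V rho) = (- t)%:M].
Proof.
move=> tr1 [big [_ [[[U [V [uU uV ->]]] can] sd0]]].
have [e01 e12] := (fidelity_sd_eq0 _).1 (esym sd0).
set T := correlation _ in e01 e12.
have dT : T = (T 0 0)%:M.
  apply: diag_entries; first by case: can.
  by elim/ord3P; rewrite // -?e12 -?e01.
have d0 : T 0 0 <= 0 by exact: canonical_equal_neg can dT.
pose t := - T 0 0.
have tE : T = (- t)%:M by rewrite /t opprK.
exists U, V, t; split => //.
have so : scaled_orthogonal t (correlation rho).
  apply/(scaled_orthogonal_local_unitary _ _ uU uV); rewrite -/T tE.
  exact: scaled_orthogonal_scalar.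
have t0 : 0 <= t by rewrite oppr_ge0.
have : max_average_fidelity rho <= (1 + t) / 2.
  (* An upper bound of the set bounds its [sup] only once the set is known to be nonempty. *)
  apply: ge_sup.
    by exists (average_fidelity (local_unitary U V rho)), U, V.
  by move=> _ [U' [V' [uU' uV' ->]]]; exact: average_fidelity_le.
move=> h; have := lt_le_trans big h; lra.
Qed.

Lemma canonical_neg_scalar rho t : 0 <= t -> correlation rho = (- t)%:M -> is_canonical rho.
Proof.
move=> t0 E; rewrite /is_canonical E; split.
- exact: scalar_mx_is_diag.
- by move=> _ k; rewrite mxE eqxx mulr1n oppr_le0.
- by rewrite det_scalar !exprS expr0 => h; exfalso; nra.
Qed.

Lemma correlation_useful_UQT rho t : complex.Re (\tr rho) = 1 -> 1 / 3 < t ->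
  correlation rho = (- t)%:M -> useful_UQT rho.
Proof.
move=> tr1 t3 E; have t0 : 0 <= t by lra.
have so : scaled_orthogonal t (correlation rho).
  by rewrite E; exact: scaled_orthogonal_scalar.
split; last first.
  exists rho; split.
    split; last exact: canonical_neg_scalar t0 E.
    by exists 1%:M, 1%:M; rewrite local_unitary1 one_unitary.
  by symmetry; apply/fidelity_sd_eq0; rewrite E !mxE.
have avg : average_fidelity rho = (1 + t) / 2.
  rewrite average_fidelityE tr1 E /mxtrace sum3 !mxE !eqxx !mulr1n; lra.
apply: (@lt_le_trans _ _ ((1 + t) / 2)); first lra.
rewrite -avg; apply: sup_ubound.
  exists ((1 + t) / 2) => _ [U' [V' [uU' uV' ->]]]; exact: average_fidelity_le.
by exists 1%:M, 1%:M; rewrite local_unitary1 one_unitary.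
Qed.

Lemma psd_quad rho (f : 'I_2 -> 'I_2 -> C) : psd rho ->
  0 <= \sum_a \sum_i \sum_b \sum_j conjc (f a i) * f b j * block rho a b i j.
Proof.
move=> psdr; have := psdr (\col_x f (mxtens_unindex x).1 (mxtens_unindex x).2).
rewrite quadE sum_mxtens; congr (is_true (0 <= _)).
apply: eq_bigr => a _; apply: eq_bigr => i _; rewrite sum_mxtens.
by apply: eq_bigr => b _; apply: eq_bigr => j _; rewrite !mxE !mxtens_indexK.
Qed.

(* The three bounds are positivity on the Bell states other than the singlet. *)
Lemma psd_bell_bound rho : psd rho -> complex.Re (\tr rho) = 1 ->
  let T := correlation rho in
  [/\ 0 <= 1 - T 0 0 + T 1 1 + T 2 2, 0 <= 1 + T 0 0 - T 1 1 + T 2 2 &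
      0 <= 1 + T 0 0 + T 1 1 - T 2 2].
Proof.
move=> psdr tr1 T.
have quad f := psd_quad f psdr.
have Re0 (z : C) : 0 <= z -> 0 <= complex.Re z.
  by case: z => x y; rewrite lecE /= => /andP[].
have [T0 [T1 T2]] := correlation_diag rho.
rewrite -tr1 /T T0 T1 T2 tr_pauli11 tr_pauli22 tr_pauli33 tr_blocks.
have ReN (z : C) : complex.Re (- z) = - complex.Re z by case: z.
rewrite !(ReD, ReN).
have q1 := Re0 _ (quad (fun a i => if a == i then (if a == 0 then 1 else -1) else 0)).
have q2 := Re0 _ (quad (fun a i => if a == i then 1 else 0)).
have q3 := Re0 _ (quad (fun a i => if a == i then 0 else 1)).
move: q1 q2 q3; rewrite !sum2 /=.
rewrite ?(conjc0, conjc1, conjcN, mul0r, mulr0, mul1r, mulr1, add0r, addr0, mulrNN, mulN1r, mulrN1, oppr0, opprK).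
rewrite !(ReD, ReN).
move: (complex.Re (block rho 0 0 0 0)) (complex.Re (block rho 0 0 1 1))
  (complex.Re (block rho 1 1 0 0)) (complex.Re (block rho 1 1 1 1))
  (complex.Re (block rho 0 1 0 1)) (complex.Re (block rho 0 1 1 0))
  (complex.Re (block rho 1 0 0 1)) (complex.Re (block rho 1 0 1 0)).
by clear; move=> c1 c2 c3 c4 c5 c6 c7 c8 q1 q2 q3; split; lra.
Qed.

(** With positive determinant the diagonal would be t, -t, -t in some order, and positivity on a
    Bell state would give 1 - 3t >= 0. Hence the given canonical form has the same T as the one
    supplied by the deviation. *)
Lemma canonical_correlation rho t : psd rho -> complex.Re (\tr rho) = 1 ->
  1 / 3 < t -> scaled_orthogonal t (correlation rho) -> is_canonical rho ->
  correlation rho = (- t)%:M.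
Proof.
move=> psdr tr1 t3 so [dT neg pos]; have [b1 b2 b3] := psd_bell_bound psdr tr1.
set T := correlation rho in so dT neg pos b1 b2 b3 *.
have sq k : T k k ^+ 2 = t ^+ 2.
  have := congr1 (fun M : 'M[R]_3 => M k k) so.
  rewrite mxE [RHS]mxE eqxx mulr1n (bigD1 k) //= [_^T _ _]mxE -expr2 big1 ?addr0 //.
  by move=> j jk; rewrite (is_diag_mxP dT) ?mul0r // eq_sym.
have pm k : T k k = t \/ T k k = - t.
  by have /eqP := sq k; rewrite eqf_sqr => /orP[] /eqP; [left|right].
apply: diag_entries => // k; have [d|/pos [l [pl ot]]] := leP (\det T) 0.
  by case: (pm k) => // e; have := neg d k; rewrite e; lra.
have other j : j != l -> T j j = - t.
  by move=> /ot [nj _]; case: (pm j) => // e; move: nj; rewrite e; lra.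
have tl : T l l = t by case: (pm l) => // e; move: pl; rewrite e; lra.
exfalso; move: tl other; elim/ord3P: l pl ot => _ _ tl other.
- by have := other 1 isT; have := other 2 isT; lra.
- by have := other 0 isT; have := other 2 isT; lra.
- by have := other 0 isT; have := other 1 isT; lra.
Qed.

End Usefulness.

(** * Classification *)

Section SphericalCoordinates.
Variable R : realType.

Lemma half_polar (x y : R) : 0 <= y -> exists r th : R,
  [/\ 0 <= r, 0 <= th <= pi, x = r * cos th & y = r * sin th].
Proof.
move=> y0; pose r := Num.sqrt (x ^+ 2 + y ^+ 2).
have r0 : 0 <= r by exact: sqrtr_ge0.
have r2 : r ^+ 2 = x ^+ 2 + y ^+ 2 by rewrite sqr_sqrtr // addr_ge0 // sqr_ge0.
have [rz|rn] := eqVneq r 0.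
  have x2 := sqr_ge0 x; have y2 := sqr_ge0 y.
  rewrite rz expr0n /= in r2.
  exists 0, 0; rewrite !mul0r lexx pi_ge0; split => //; apply/eqP; rewrite -sqrf_eq0; apply/eqP; lra.
have rp : 0 < r by rewrite lt_neqAle eq_sym rn.
pose u := x / r.
have u2 : 1 - u ^+ 2 = (y / r) ^+ 2.
  have -> : u ^+ 2 = x ^+ 2 / r ^+ 2 by rewrite expr_div_n.
  rewrite expr_div_n (_ : y ^+ 2 = r ^+ 2 - x ^+ 2); last by rewrite r2; ring.
  by rewrite mulrBl divff // expf_neq0.
have u1 : -1 <= u <= 1.
  by rewrite -ler_norml -(@ler_pXn2r _ 2) ?nnegrE // expr1n real_normK ?num_real //;
     have := sqr_ge0 (y / r); lra.
exists r, (acos u); rewrite acosK ?in_itv // sin_acos // u2 sqrtr_sqr.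
rewrite ger0_norm ?divr_ge0 // acos_ge0 // acos_lepi // /u.
by split => //; field.
Qed.

Lemma polar (x y : R) : exists r ph : R,
  [/\ 0 <= r, 0 <= ph <= 2 * pi, x = r * cos ph & y = r * sin ph].
Proof.
have p0 := pi_ge0 R; have [y0|y0] := leP 0 y.
  have [r [ph [r0 /andP[a b] ex ey]]] := half_polar x y0.
  by exists r, ph; split => //; apply/andP; split => //; lra.
have yN : 0 <= - y by lra.
have [r [ph [r0 /andP[a b] ex ey]]] := half_polar x yN.
(* A point below the axis is reflected: this angle has the same cosine and the opposite sine. *)
exists r, (2 * pi - ph); split => //.
- by apply/andP; split; lra.
- by rewrite ex mulr_natl addrC cosD2pi cosN.
- by rewrite mulr_natl addrC sinD2pi sinN; lra.
Qed.

Lemma spherical (x y z : R) : exists r th ph : R,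
  [/\ 0 <= r, 0 <= th <= pi, 0 <= ph <= 2 * pi &
   [/\ x = r * (sin th * cos ph), y = r * (sin th * sin ph) & z = r * cos th]].
Proof.
have [q [ph [q0 phr -> ->]]] := polar x y.
have [r [th [r0 thr -> ->]]] := half_polar z q0.
by exists r, th, ph; split => //; split; rewrite ?mulrA.
Qed.
End SphericalCoordinates.

(** * Singular states and the length of the Bloch vector *)

Section RankThree.
Variable R : realType.
Local Notation C := R[i].

Lemma singular_left_null n (A : 'M[C]_n) : (\rank A < n)%N ->
  exists2 v : 'rV[C]_n, v != 0 & v *m A = 0.
Proof.
move=> rA; have : kermx A != 0 by rewrite -mxrank_eq0 mxrank_ker subn_eq0 -ltnNge.
by move=> /rowV0Pn [v /sub_kermxP vA v0]; exists v.
Qed.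

Lemma bloch_state_null_eqs t (s : nat -> R) (v : 'rV[C]_(2 * 2))
    (w := fun a i : 'I_2 => v 0 (mxtens_index (a, i)))
    (s3 := (s 3)%:C) (sm := (s 1)%:C - 'i%C * (s 2)%:C) (sp := (s 1)%:C + 'i%C * (s 2)%:C) :
  v *m bloch_state t s = 0 ->
  [/\ w 0 0 * (1 + s3 - t%:C) + w 0 1 * sp = 0,
      w 0 0 * sm + w 0 1 * (1 - s3 + t%:C) - 2 * t%:C * w 1 0 = 0,
      w 1 0 * (1 + s3 + t%:C) + w 1 1 * sp - 2 * t%:C * w 0 1 = 0 &
      w 1 0 * sm + w 1 1 * (1 - s3 - t%:C) = 0].
Proof.
move=> vA.
have E (b j : 'I_2) : 4 * \sum_a \sum_i w a i * block (bloch_state t s) a b i j = 0.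
  have := congr1 (fun M : 'rV[C]_(2 * 2) => M 0 (mxtens_index (b, j))) vA.
  rewrite mxE sum_mxtens [RHS]mxE => h.
  under eq_bigr => a _ do under eq_bigr => i _ do rewrite blockE.
  by rewrite h mulr0.
have four : 4 * 4^-1 = 1 :> C by rewrite divff // pnatr_eq0.
have F (b j : 'I_2) :
  (forall y, \sum_a \sum_i w a i * block (bloch_state t s) a b i j = 4^-1 * y -> y = 0).
  by move=> y hy; have := E b j; rewrite hy mulrA four mul1r.
have B (a b i j : 'I_2) : block (bloch_state t s) a b i j = 4^-1 *
  ((a == b)%:R * mx2 (1 + s3) sm sp (1 - s3) i j
   - t%:C * (if a == b then (if a == 0 then mx2 1 0 0 (- 1) else mx2 (- 1) 0 0 1)
              else (if a == 0 then mx2 0 0 2 0 else mx2 0 2 0 0)) i j).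
  by rewrite block_bloch_state entryZ entryD entryN 2!entryZ.
split; [apply: (F 0 0)|apply: (F 0 1)|apply: (F 1 0)|apply: (F 1 1)];
  rewrite !sum2 !B /= !mx2E; ring.
Qed.

(** Up to a constant the determinant is ((1 - t)^2 - r2)((1 - t)(1 + 3t) - r2). If r2 < (1 - t)^2
    both factors are nonzero, and the elimination divides by them, up to sign, as [d2] and [d1]. *)
Lemma bloch_state_singular t (s : nat -> R) (r2 := s 1 ^+ 2 + s 2 ^+ 2 + s 3 ^+ 2) :
  (\rank (bloch_state t s) < 4)%N -> 0 < t < 1 -> r2 <= (1 - t) ^+ 2 -> r2 = (1 - t) ^+ 2.
Proof.
move=> rk /andP[t0 t1] le; apply/eqP; rewrite eq_le le /= leNgt; apply/negP => lt.
have [v v0 vA] := @singular_left_null (2 * 2) _ rk.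
have := bloch_state_null_eqs vA; cbv beta zeta => -[].
set x := v 0 (mxtens_index (0, 0)); set y := v 0 (mxtens_index (0, 1)).
set z := v 0 (mxtens_index (1, 0)); set w := v 0 (mxtens_index (1, 1)).
have NC : ((s 1)%:C - 'i%C * (s 2)%:C) * ((s 1)%:C + 'i%C * (s 2)%:C) + (s 3)%:C ^+ 2 = r2%:C.
  transitivity ((s 1)%:C ^+ 2 - ('i%C * 'i%C) * (s 2)%:C ^+ 2 + (s 3)%:C ^+ 2); first ring.
  by rewrite mulii mulN1r opprK -!rmorphXn -!rmorphD.
clearbody r2.
have real_neq0 (q : R) (q' : C) : q != 0 -> q' = q%:C -> q' != 0.
  by move=> q0 ->; rewrite fmorph_eq0.
have d1 : r2%:C - (1 - t%:C) * (1 + 3 * t%:C) != 0 :> C.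
  apply: (@real_neq0 (r2 - (1 - t) * (1 + 3 * t))); last by ring.
  by rewrite lt_eqF // subr_lt0 (lt_trans lt) // expr2; nra.
have d2 : (1 - t%:C) ^+ 2 - r2%:C != 0 :> C.
  apply: (@real_neq0 ((1 - t) ^+ 2 - r2)); last by ring.
  by rewrite gt_eqF // subr_gt0.
have d3 : 2 * (1 - t%:C) != 0 :> C.
  apply: (@real_neq0 (2 * (1 - t))); last by ring.
  by rewrite gt_eqF //; lra.
move: d1 d2 d3; rewrite -NC.
move: ((s 1)%:C - 'i%C * (s 2)%:C) ((s 1)%:C + 'i%C * (s 2)%:C) (s 3)%:C t%:C => m p c k d1 d2 d3 e1 e2 e3 e4.
(* The singlet component of the null vector vanishes first. *)
have yz : y - z = 0.
  apply: (mulfI d1); rewrite mulr0.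
  transitivity (m * (x * (1 + c - k) + y * p) - c * ((x * m + y * (1 - c + k) - 2 * k * z)
     + (z * (1 + c + k) + w * p - 2 * k * y)) - p * (z * m + w * (1 - c - k))
     - (1 - k) * ((x * m + y * (1 - c + k) - 2 * k * z) - (z * (1 + c + k) + w * p - 2 * k * y))).
    ring.
  by rewrite e1 e2 e3 e4; ring.
have zy : z = y by apply/esym/eqP; rewrite -subr_eq0 yz.
rewrite zy in e1 e2 e3 e4.
have x0 : x = 0.
  apply: (mulfI d2); rewrite mulr0.
  transitivity ((1 - k - c) * (x * (1 + c - k) + y * p) - p * (x * m + y * (1 - c + k) - 2 * k * y)).
    ring.
  by rewrite e1 e2; ring.
have w0 : w = 0.
  apply: (mulfI d2); rewrite mulr0.
  transitivity ((1 - k + c) * (y * m + w * (1 - c - k)) - m * (y * (1 + c + k) + w * p - 2 * k * y)).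
    ring.
  by rewrite e3 e4; ring.
have y0 : y = 0.
  apply: (mulfI d3); rewrite mulr0.
  transitivity ((x * m + y * (1 - c + k) - 2 * k * y) + (y * (1 + c + k) + w * p - 2 * k * y) - x * m - w * p).
    ring.
  by rewrite e2 e3 x0 w0; ring.
case/negP: v0; apply/eqP/matrixP => i q; rewrite (ord1 i) [RHS]mxE.
rewrite -(mxtens_unindexK q); case: (mxtens_unindex q) => a b.
elim/ord2P: a; elim/ord2P: b; [exact: x0|exact: y0| |exact: w0].
by rewrite -[LHS]/z zy.
Qed.
End RankThree.

Section Classification.
Variable R : realType.
Local Notation C := R[i].

Lemma eq_bloch_state t (s s' : nat -> R) : s 1 = s' 1 -> s 2 = s' 2 -> s 3 = s' 3 ->
  bloch_state t s = bloch_state t s'.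
Proof.
move=> e1 e2 e3; rewrite /bloch_state.
rewrite (eq_bigr (fun k : 'I_3 => (s' k.+1)%:C *: pauli R k.+1)) // => k _.
by congr (_%:C *: _); elim/ord3P: k.
Qed.

Lemma bloch_state_bound t r th ph (s : nat -> R) :
  s 1 = r * (sin th * cos ph) -> s 2 = r * (sin th * sin ph) -> s 3 = r * cos th ->
  psd (bloch_state t s) -> r <= 1 - t.
Proof.
move=> s1 s2 s3 psds.
pose p : C := (sin (th / 2))%:C.
pose q : C := - ((cos (th / 2))%:C * expi ph).
(* [(p, q)] is the spinor whose Bloch vector is opposite to [s]. *)
have := psd_quad (fun a i => pair2 p q a * pair2 p q i) psds.
pose A := mx2 (p * conjc p) (p * conjc q) (q * conjc p) (q * conjc q).
have AE a b : A b a = pair2 p q b * conjc (pair2 p q a).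
  by elim/ord2P: a; elim/ord2P: b; rewrite mx2E !pair2E.
have -> : \sum_a \sum_i \sum_b \sum_j conjc (pair2 p q a * pair2 p q i) *
    (pair2 p q b * pair2 p q j) * block (bloch_state t s) a b i j
    = \tr (bloch_state t s *m (A *t A)).
  rewrite tr_mul_tens; apply: eq_bigr => a _; rewrite exchange_big /=.
  apply: eq_bigr => b _; rewrite /mxtrace mulr_sumr; apply: eq_bigr => i _.
  rewrite [(_ *m _) i i]mxE mulr_sumr; apply: eq_bigr => j _.
  by rewrite !AE conjcM; ring.
have e : th = (th / 2) *+ 2 by rewrite -mulr_natr mulfVK // pnatr_eq0.
have sa : sin th = 2 * (cos (th / 2) * sin (th / 2)).
  by rewrite {1}e sin_mulr2n mulr_natl.
have ca : cos th = cos (th / 2) * cos (th / 2) - sin (th / 2) * sin (th / 2).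
  by rewrite {1}e cos_mulr2n cos_sin_sq expr2 mulr2n; ring.
have n1 : cos (th / 2) * cos (th / 2) + sin (th / 2) * sin (th / 2) = 1.
  by rewrite cos_sin_sq; ring.
have n2 : cos ph * cos ph + sin ph * sin ph = 1 by rewrite cos_sin_sq; ring.
have pE : p * conjc p = (sin (th / 2) * sin (th / 2))%:C.
  by rewrite /p conjc_real -rmorphM.
have qE : q * conjc q = (cos (th / 2) * cos (th / 2))%:C.
  rewrite /q conjcN mulrNN conjcM conjc_real mulrACA expi_unit mulr1 -rmorphM //.
have pqE : p * conjc q = - (sin (th / 2) * cos (th / 2))%:C * conjc (expi ph).
  by rewrite /p /q conjcN conjcM conjc_real rmorphM; ring.
have qpE : q * conjc p = - (sin (th / 2) * cos (th / 2))%:C * expi ph.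
  by rewrite /p /q conjc_real rmorphM; ring.
rewrite tr_bloch_state !sum3 /A tr_mx2 /= !mul_mx2 !tr_mx2 pE qE pqE qpE s1 s2 s3 sa ca.
clear A AE pE qE pqE qpE p q e sa ca.
move: n1 n2; rewrite /expi.
move: (cos (th / 2)) (sin (th / 2)) (cos ph) (sin ph) => c d x y n1 n2.
have -> : 0 * (d * d)%:C + 1 * (- (d * c)%:C * (x +i* y)) +
     (1 * (- (d * c)%:C * (x +i* y)^*%C) + 0 * (c * c)%:C) = (- (2 * (d * c) * x))%:C.
  by apply/eqP; rewrite eq_complex; apply/andP; split; apply/eqP; simpc => /=; ring.
have -> : 0 * (d * d)%:C + - 'i%C * (- (d * c)%:C * (x +i* y)) +
     ('i%C * (- (d * c)%:C * (x +i* y)^*%C) + 0 * (c * c)%:C) = (- (2 * (d * c) * y))%:C.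
  by apply/eqP; rewrite eq_complex; apply/andP; split; apply/eqP; simpc => /=; ring.
have -> : 1 * (d * d)%:C + 0 * (- (d * c)%:C * (x +i* y)) +
     (0 * (- (d * c)%:C * (x +i* y)^*%C) + -1 * (c * c)%:C) = (d * d - c * c)%:C.
  by rewrite rmorphB; ring.
set S := (X in 4^-1 * X).
have -> : S = ((d * d + c * c) * (d * d + c * c) + (d * d + c * c) *
   (r * (2 * (c * d) * x) * - (2 * (d * c) * x) + r * (2 * (c * d) * y) * - (2 * (d * c) * y)
    + r * (c * c - d * d) * (d * d - c * c))
   - t * (- (2 * (d * c) * x) * - (2 * (d * c) * x) + - (2 * (d * c) * y) * - (2 * (d * c) * y)
    + (d * d - c * c) * (d * d - c * c)))%:C.
  by rewrite /S; ring.
rewrite pmulr_rge0 ?invr_gt0 ?ltr0n // ler0c.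
have -> : (d * d + c * c) * (d * d + c * c) + (d * d + c * c) *
   (r * (2 * (c * d) * x) * - (2 * (d * c) * x) + r * (2 * (c * d) * y) * - (2 * (d * c) * y)
    + r * (c * c - d * d) * (d * d - c * c))
   - t * (- (2 * (d * c) * x) * - (2 * (d * c) * x) + - (2 * (d * c) * y) * - (2 * (d * c) * y)
    + (d * d - c * c) * (d * d - c * c)) = 1 - r - t.
  transitivity ((c * c + d * d) ^+ 2 - (r * (c * c + d * d) + t) *
    (4 * (c * c) * (d * d) * (x * x + y * y) + (c * c - d * d) ^+ 2)); first ring.
  rewrite n2 n1; transitivity (1 - (r + t) * (c * c + d * d) ^+ 2); first ring.
  by rewrite n1; ring.
lra.
Qed.

Lemma tr_herm_Im n (X P : 'M[C]_n) : X ^t* = X -> P ^t* = P -> complex.Im (\tr (X *m P)) = 0.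
Proof.
move=> hX hP.
have e : \tr (X *m P) = conjc (\tr (X *m P)).
  rewrite -{1}hX -{1}hP -adj_mul mxtrace_mulC /mxtrace (rmorph_sum conjc) /=.
  apply: eq_bigr => i _; rewrite adjE.
  by congr conjc; congr (_ i i).
by move: e; case: (\tr _) => a b [] /=; lra.
Qed.

Lemma tr_block_choi (L : 'M[C]_2 -> 'M[C]_2) a b : trace_preserving L ->
  \tr (block (choi L) a b) = 2^-1 * (a == b)%:R.
Proof.
move=> tp; rewrite block_choi tp mxtraceZ; congr (_ * _).
by elim/ord2P: a; elim/ord2P: b; rewrite tr2 !mxE /=; ring.
Qed.

(** Trace preservation means that the untouched qubit is left maximally mixed. *)
Lemma tr_choi_left (L : 'M[C]_2 -> 'M[C]_2) (A : 'M[C]_2) : trace_preserving L ->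
  \tr (choi L *m (A *t 1%:M)) = 2^-1 * \tr A.
Proof.
move=> tp; rewrite tr_mul_tens !sum2 !mulmx1 !tr_block_choi // tr2 /=; ring.
Qed.

Lemma tr_choi (L : 'M[C]_2 -> 'M[C]_2) : trace_preserving L -> \tr (choi L) = 1.
Proof.
move=> tp; rewrite -[choi L]mulmx1 -tens_one tr_choi_left // tr2 !mxE /=.
by rewrite -natrD mulVf // pnatr_eq0.
Qed.

Lemma pauli_lift (j : 'I_3) : pauli R (lift (ord0 : 'I_4) j) = pauli R j.+1.
Proof. by []. Qed.

(** The sixteen Pauli coefficients fall into four kinds: correlations given by T, coefficients on
    the first qubit killed by trace preservation, those on the second qubit, which define s, and the
    trace. Hermiticity makes them real, so taking [complex.Re] loses nothing. *)
Lemma choi_bloch_state (L : 'M[C]_2 -> 'M[C]_2) t : trace_preserving L ->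
  psd (choi L) -> correlation (choi L) = (- t)%:M ->
  exists s : nat -> R, choi L = bloch_state t s.
Proof.
move=> tp psdc corr; have herm := psd_adj psdc.
pose s (k : nat) := complex.Re (\tr (choi L *m (1%:M *t pauli R k))).
exists s; apply: eq_pauli_tr => k l; rewrite tr_bloch_state.
have hp j := adj_pauli R j.
have h1 : (1%:M : 'M[C]_2) ^t* = 1%:M.
  by apply/matrixP => i j; rewrite adjE !mxE conjc_nat eq_sym.
have ReE (z : C) : complex.Im z = 0 -> z = (complex.Re z)%:C by case: z => a b /= ->.
have tr1 : \tr (1%:M : 'M[C]_2) = 2 by rewrite tr2 !mxE.
case: (unliftP ord0 k) => [k' ->|->]; case: (unliftP ord0 l) => [l' ->|->];
  rewrite ?pauli_lift -?[pauli R (nat_of_ord ord0)]/(1%:M).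
- rewrite [LHS]ReE; last by apply: tr_herm_Im => //; rewrite adj_tens !hp.
  have := congr1 (fun M : 'M[R]_3 => M k' l') corr; rewrite !mxE => ->.
  rewrite tr_pauli !mul0r !add0r (bigD1 k') //= big1 ?addr0 => [|j jk]; last first.
    by rewrite tr_pauli_mul (negPf jk) mulr0 mul0r.
  rewrite !tr_pauli_mul eqxx mulr1n.
  case: (k' == l'); rewrite ?mulr1n ?mulr0n; last by rewrite rmorph0; ring.
  by field.
- rewrite tr_choi_left // tr_pauli !mul0r mulr0 add0r big1 ?mulr0 ?subr0 ?mulr0 // => j _.
  by rewrite mulmx1 tr_pauli mulr0.
- rewrite [LHS]ReE; last by apply: tr_herm_Im => //; rewrite adj_tens h1 hp.
  rewrite -/(s l'.+1) tr_pauli mulr0 add0r tr1.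
  rewrite [X in _ - _ * X]big1 => [|j _]; last by rewrite mulmx1 tr_pauli mul0r.
  rewrite (bigD1 l') //= big1 ?addr0 => [|j jl]; last by rewrite tr_pauli_mul (negPf jl) !mulr0.
  by rewrite tr_pauli_mul eqxx mulr1n; move: (s l'.+1) => z; field.
- rewrite tr_choi_left // tr1.
  rewrite big1 => [|j _]; last by rewrite mulmx1 tr_pauli mulr0.
  rewrite big1 => [|j _]; last by rewrite mulmx1 tr_pauli mul0r.
  by field.
Qed.

Lemma linear_mxD (M : 'M[C]_2 -> 'M[C]_2) : linear M ->
  forall A B, M (A + B) = M A + M B.
Proof. by move=> lM A B; have := lM 1 A B; rewrite !scale1r. Qed.

Lemma linear_mx0 (M : 'M[C]_2 -> 'M[C]_2) : linear M -> M 0 = 0.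
Proof.
by move=> lM; apply: (@addrI _ (M 0)); rewrite -linear_mxD // !addr0.
Qed.

Lemma linear_mxZ (M : 'M[C]_2 -> 'M[C]_2) : linear M ->
  forall c A, M (c *: A) = c *: M A.
Proof.
move=> lM c A; rewrite -[LHS](congr1 M (addr0 (c *: A))).
by rewrite [LHS](lM c A 0) linear_mx0 // addr0.
Qed.

Lemma linear_mx_expand (M : 'M[C]_2 -> 'M[C]_2) (lM : linear M) (X : 'M[C]_2) :
  M X = X 0 0 *: M (delta_mx 0 0) + X 0 1 *: M (delta_mx 0 1)
    + (X 1 0 *: M (delta_mx 1 0) + X 1 1 *: M (delta_mx 1 1)).
Proof.
rewrite [in LHS](matrix_sum_delta X) !sum2.
by rewrite !(linear_mxD lM) !(linear_mxZ lM).
Qed.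

Lemma linear_delta (L L' : 'M[C]_2 -> 'M[C]_2) : linear L -> linear L' ->
  choi L = choi L' -> forall X, L X = L' X.
Proof.
move=> lL lL' E X.
have d a b : L (delta_mx a b) = L' (delta_mx a b).
  have := congr1 (fun Y => block Y a b) E.
  rewrite !block_choi (linear_mxZ lL) (linear_mxZ lL').
  by apply: scalerI; rewrite invr_neq0 // pnatr_eq0.
by rewrite (linear_mx_expand lL) (linear_mx_expand lL') (d 0 0) (d 0 1) (d 1 0) (d 1 1).
Qed.

(** The identity is sent to 1 + s.sigma, so a vanishing s would make the channel unital; this is how
    non-unitality enters the classification. *)
Lemma choi_bloch_state_one (L : 'M[C]_2 -> 'M[C]_2) t (s : nat -> R) :
  linear L -> choi L = bloch_state t s ->
  L 1%:M = mx2 (1 + (s 3)%:C) ((s 1)%:C - 'i%C * (s 2)%:C)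
     ((s 1)%:C + 'i%C * (s 2)%:C) (1 - (s 3)%:C).
Proof.
move=> lL E.
have half a : delta_mx a a = 2 *: (2^-1 *: delta_mx a a) :> 'M[C]_2.
  by rewrite scalerA divff ?pnatr_eq0 // scale1r.
have -> : 1%:M = delta_mx 0 0 + delta_mx 1 1 :> 'M[C]_2.
  by apply: eq_mx2; rewrite !mxE /= ?addr0 ?add0r.
rewrite (half 0) (half 1) (linear_mxD lL) !(linear_mxZ lL _ (2^-1 *: _)).
rewrite -!block_choi E !block_bloch_state /= !scale1r.
have two : 2 != 0 :> C by rewrite pnatr_eq0.
by rewrite -!scaleNr !scale_mx2 !add_mx2 !scale_mx2 !add_mx2; congr mx2; field.
Qed.

Lemma channel_classification (L : 'M[C]_2 -> 'M[C]_2) t :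
  linear L -> trace_preserving L -> psd (choi L) -> ~ unital L ->
  \rank (choi L) = 3%N -> 1 / 3 < t -> correlation (choi L) = (- t)%:M ->
  exists th ph : R, [/\ parameter_range t th ph, choi L = final_state t th ph &
    forall X, L X = kraus_map (kraus t th ph) X].
Proof.
move=> lL tp psdc nu rk t3 corr.
have [s E] := choi_bloch_state tp psdc corr.
have [r [th [ph [r0 thr phr [s1 s2 s3]]]]] := spherical (s 1) (s 2) (s 3).
have rt : r <= 1 - t by apply: (bloch_state_bound s1 s2 s3); rewrite -E.
have one := choi_bloch_state_one lL E.
(* Otherwise 0 <= r <= 1 - t forces r = 0, and the channel would be unital. *)
have t1 : t < 1.
  rewrite ltNge; apply/negP => t1; apply: nu; rewrite /unital one.
  have rz : r = 0 by lra.
  rewrite s1 s2 s3 rz !mul0r; apply: eq_mx2; rewrite !mxE /=; simpc => //=.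
have t01 : 0 < t < 1 by apply/andP; split; lra.
have r2E : s 1 ^+ 2 + s 2 ^+ 2 + s 3 ^+ 2 = r ^+ 2.
  rewrite s1 s2 s3.
  transitivity (r ^+ 2 * (sin th ^+ 2 * (cos ph ^+ 2 + sin ph ^+ 2) + cos th ^+ 2)); first ring.
  by rewrite cos2Dsin2 mulr1 addrC cos2Dsin2 mulr1.
have rE : r = 1 - t.
  have rk4 : (\rank (bloch_state t s) < 4)%N by rewrite -E rk.
  have := bloch_state_singular rk4 t01; rewrite r2E => h.
  apply/eqP; rewrite -(@eqrXn2 _ 2) //; last lra.
  by apply/eqP/h; rewrite ler_pXn2r // nnegrE; lra.
have EF : choi L = final_state t th ph.
  rewrite E; apply: (@eq_bloch_state t s (svec t th ph)).
  - by rewrite s1 rE.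
  - by rewrite s2 rE.
  - by rewrite s3 rE.
exists th, ph; split => //; first by split => //; apply/andP; split.
apply: linear_delta => //; first exact: kraus_linear.
by rewrite choi_kraus.
Qed.
End Classification.

Lemma mulmx_sandwich_comb (F : comPzRingType) n (V W A B D E : 'M[F]_n) a b d e :
  V *m (a *: A + b *: B + (d *: D + e *: E)) *m W =
  a *: (V *m A *m W) + b *: (V *m B *m W) + (d *: (V *m D *m W) + e *: (V *m E *m W)).
Proof. by rewrite !(mulmxDr, mulmxDl) -!scalemxAr -!scalemxAl. Qed.

Lemma mxrank_unit_sandwich (F : fieldType) n (A X B : 'M[F]_n) :
  A \in unitmx -> B \in unitmx -> \rank (A *m X *m B) = \rank X.
Proof.
move=> uA uB; rewrite mxrankMfree ?row_free_unit //.
by rewrite eqmxMfull // row_full_unit.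
Qed.

(** * Rotation by local unitaries, and the channel properties of the class *)

Section Rotation.
Variable R : realType.
Local Notation C := R[i].
Implicit Types (U V : 'M[C]_2) (L : 'M[C]_2 -> 'M[C]_2).

Lemma choi_rotate U V L : linear L ->
  choi (rotate U V L) = local_unitary U V (choi L).
Proof.
move=> lL; apply: eq_block => a b; rewrite block_choi /local_unitary adj_tens block_mulmx.
rewrite /rotate -scalemxAr -scalemxAl (linear_mxZ lL) -scalemxAr -scalemxAl.
under eq_bigr => c _ do under eq_bigr => d _ do
  rewrite block_choi (linear_mxZ lL) -scalemxAr -scalemxAl scalerA mulrC -scalerA adjE.
under eq_bigr => c _ do rewrite -scaler_sumr.
rewrite -scaler_sumr; congr (_ *: _).
have e c d : (U^T *m delta_mx a b *m U^T ^t*) c d = U a c * conjc (U b d).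
  by rewrite mul_delta_mx_entry adjE 2!mxE.
rewrite (linear_mx_expand lL) (e 0 0) (e 0 1) (e 1 0) (e 1 1) !sum2.
exact: mulmx_sandwich_comb.
Qed.

Lemma rotate_linear U V L : linear L -> linear (rotate U V L).
Proof.
move=> lL c X Y; rewrite /rotate mulmxDr mulmxDl -scalemxAr -scalemxAl.
by rewrite (linear_mxD lL) (linear_mxZ lL) mulmxDr mulmxDl -scalemxAr -scalemxAl.
Qed.

Lemma rotate_trace_preserving U V L : U \is unitarymx -> V \is unitarymx ->
  trace_preserving L -> trace_preserving (rotate U V L).
Proof.
move=> uU uV tp X; rewrite /rotate mxtrace_mulC mulmxA unitary_Vmul // mul1mx tp.
by rewrite mxtrace_mulC mulmxA unitary_Vmul ?trmx_unitary // mul1mx.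
Qed.

Lemma rotate_unital U V L : U \is unitarymx -> V \is unitarymx ->
  unital (rotate U V L) -> unital L.
Proof.
move=> uU uV; rewrite /unital /rotate mulmx1 unitary_mulV ?trmx_unitary // => h.
have := congr1 (fun M => V ^t* *m M *m V) h.
by rewrite !mulmxA unitary_Vmul // mul1mx -mulmxA unitary_Vmul // mulmx1 mulmx1 unitary_Vmul.
Qed.

Lemma rank_local_unitary U V (rho : 'M[C]_(2 * 2)) : U \is unitarymx -> V \is unitarymx ->
  \rank (local_unitary U V rho) = \rank rho.
Proof.
move=> uU uV; have [u1 u2] := mulmx1_unit (tens_unitary_Vmul uU uV).
exact: (@mxrank_unit_sandwich C _ (U *t V) rho ((U *t V) ^t*) u2 u1).
Qed.

(** The entry (a, b) is the trace of the image of a matrix unit, hence twice the trace of a block of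
    the final state; the Kraus entries need not be multiplied out again. *)
Lemma kraus_completeness (t th ph : R) : 0 < t < 1 ->
  \sum_(i < 3) (kraus t th ph i) ^t* *m kraus t th ph i = 1%:M.
Proof.
move=> t01; have E := choi_kraus th ph t01.
apply/matrixP => a b; rewrite summxE.
have -> : \sum_(k < 3) ((kraus t th ph k) ^t* *m kraus t th ph k) a b =
   \tr (kraus_map (kraus t th ph) (delta_mx b a)).
  rewrite /mxtrace; under [RHS]eq_bigr => i _ do rewrite kraus_map_delta.
  rewrite exchange_big; apply: eq_bigr => k _; rewrite mxE.
  by apply: eq_bigr => n _; rewrite adjE mulrC.
have := congr1 (fun X => 2 * \tr (block X b a)) E.
rewrite /= block_choi (linear_mxZ (kraus_linear _)) mxtraceZ mulrA divff ?pnatr_eq0 // mul1r => ->.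
have -> : final_state t th ph = bloch_state t (svec t th ph) by [].
rewrite block_bloch_state mxE; elim/ord2P: a; elim/ord2P: b; rewrite /= tr2 !entryE !mx2E; by field.
Qed.

Lemma kraus_trace_preserving (t th ph : R) : 0 < t < 1 ->
  trace_preserving (kraus_map (kraus t th ph)).
Proof.
move=> t01 X; rewrite /kraus_map tr_sum.
under eq_bigr => k _ do rewrite mxtrace_mulC mulmxA.
by rewrite -tr_sum -mulmx_suml kraus_completeness // mul1mx.
Qed.

(** Unitality would make s vanish: one diagonal entry gives cos th = 0, one off-diagonal entry gives
    sin th = 0, because 1 - t and the phase are nonzero. *)
Lemma kraus_not_unital (t th ph : R) : 0 < t < 1 ->
  kraus_map (kraus t th ph) 1%:M <> 1%:M.
Proof.
move=> t01 u; have /andP[t0 t1] := t01.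
have E := choi_kraus th ph t01; rewrite -[final_state _ _ _]/(bloch_state t (svec t th ph)) in E.
have one := choi_bloch_state_one (@kraus_linear R 3 (kraus t th ph)) E.
rewrite u in one; have [em ep] := svec_expi t th ph; rewrite em ep in one.
have e a b : ((1%:M : 'M[C]_2) a b) = (a == b)%:R by rewrite mxE.
have h00 := congr1 (fun M : 'M[C]_2 => M 0 0) one.
have h10 := congr1 (fun M : 'M[C]_2 => M 1 0) one.
rewrite e mx2E in h00; rewrite e mx2E in h10.
have a0 : 1 - t != 0 by rewrite gt_eqF // subr_gt0.
have c0 : cos th = 0.
  move: h00 => /eqP; rewrite eqxx mulr1n eq_sym -subr_eq0 addrAC subrr add0r.
  by rewrite fmorph_eq0 /= mulf_eq0 (negPf a0) => /eqP.
have e0 : expi ph != 0.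
  apply/eqP => z; have := expi_unit ph; rewrite z mul0r => /esym/eqP.
  by rewrite oner_eq0.
have s0 : sin th = 0.
  move: h10 => /esym/eqP; rewrite mulf_eq0 (negPf e0) orbF -rmorphM fmorph_eq0.
  by rewrite mulf_eq0 (negPf a0) => /eqP.
by have := cos2Dsin2 th; rewrite c0 s0 expr0n /= addr0 => /esym/eqP; rewrite oner_eq0.
Qed.

End Rotation.

Theorem mainTheorem11 (R : realType) :
  (* every such channel with canonical final state belongs to the class *)
  (forall L : 'M[R[i]]_2 -> 'M[R[i]]_2,
     qubit_channel L -> ~ unital L -> \rank (choi L) = 3%N ->
     useful_UQT (choi L) -> is_canonical (choi L) ->
     exists t th ph : R,
       [/\ parameter_range t th ph,
           choi L = final_state t th ph &
           forall X, L X = kraus_map (kraus t th ph) X])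
  /\
  (* the final state can be taken canonical without loss of generality *)
  (forall L : 'M[R[i]]_2 -> 'M[R[i]]_2,
     qubit_channel L -> ~ unital L -> \rank (choi L) = 3%N ->
     useful_UQT (choi L) ->
     exists (U V : 'M[R[i]]_2) (t th ph : R),
       [/\ U \is unitarymx /\ V \is unitarymx,
           choi (rotate U V L) = local_unitary U V (choi L) /\
             is_canonical (choi (rotate U V L)),
           parameter_range t th ph,
           choi (rotate U V L) = final_state t th ph &
           forall X, rotate U V L X = kraus_map (kraus t th ph) X])
  /\
  (* the members of the class *)
  (forall t th ph : R, parameter_range t th ph ->
     let K := kraus t th ph in
     let L := kraus_map K in
     (forall (i : 'I_3) (j k : 'I_2),
        complex.Re (kraus_formula t x ph i j k) @[x --> th^']
          --> complex.Re (K i j k) /\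
        complex.Im (kraus_formula t x ph i j k) @[x --> th^']
          --> complex.Im (K i j k)) /\
     (forall i j : 'I_3, i != j -> \tr ((K i) ^t* *m K j) = 0) /\
     \sum_(i < 3) (K i) ^t* *m K i = 1%:M /\
     \sum_(i < 3) K i *m (K i) ^t* <> 1%:M /\
     psd (choi L) /\
     qubit_channel L /\
     ~ unital L /\
     choi L = final_state t th ph /\
     is_canonical (choi L) /\
     \rank (choi L) = 3%N /\
     useful_UQT (choi L)).
Proof.
have TPsum (t th ph : R) : parameter_range t th ph -> 0 < t < 1.
  by case=> /andP[a b] _ _; apply/andP; split => //; lra.
split; [|split].
- move=> L [lL cp tp] nu rk use can.
  have psdc : psd (choi L) by apply: cp; exact: psd_rank1.
  have tr1 : complex.Re (\tr (choi L)) = 1 by rewrite tr_choi.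
  have [U [V [t [uU uV t3 canC corrC]]]] := useful_UQT_correlation tr1 use.
  (* The canonical form behind the zero deviation may be a rotated copy of [choi L]; only T T^T is
     carried back, and canonicity of [choi L] itself fixes the rest. *)
  have so : scaled_orthogonal t (correlation (choi L)).
    apply/(scaled_orthogonal_local_unitary _ _ uU uV); rewrite corrC.
    exact: scaled_orthogonal_scalar.
  have corr := canonical_correlation psdc tr1 t3 so can.
  have [th [ph h]] := channel_classification lL tp psdc nu rk t3 corr.
  by exists t, th, ph.
- move=> L [lL cp tp] nu rk use.
  have psdc : psd (choi L) by apply: cp; exact: psd_rank1.
  have tr1 : complex.Re (\tr (choi L)) = 1 by rewrite tr_choi.
  have [U [V [t [uU uV t3 canC corrC]]]] := useful_UQT_correlation tr1 use.
  have E := choi_rotate U V lL.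
  have psdr : psd (choi (rotate U V L)) by rewrite E; exact: psd_congr.
  have nur : ~ unital (rotate U V L) by move=> /(rotate_unital uU uV).
  have rkr : \rank (choi (rotate U V L)) = 3%N by rewrite E rank_local_unitary.
  have corr : correlation (choi (rotate U V L)) = (- t)%:M by rewrite E.
  have [th [ph [pr fs km]]] := channel_classification (rotate_linear U V lL)
    (rotate_trace_preserving uU uV tp) psdr nur rkr t3 corr.
  by exists U, V, t, th, ph; split => //; split => //; rewrite E.
- move=> t th ph pr K L; have t01 := TPsum _ _ _ pr.
  have t3 : 1 / 3 < t by case: pr => /andP[].
  have E : choi L = final_state t th ph := choi_kraus th ph t01.
  have corr : correlation (choi L) = (- t)%:M.
    by rewrite E; exact: correlation_bloch_state.
  have lL : linear L := @kraus_linear R 3 K.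
  have tp : trace_preserving L := @kraus_trace_preserving R t th ph t01.
  have cp : completely_positive L := @kraus_completely_positive R 3 K.
  have nu : ~ unital L := @kraus_not_unital R t th ph t01.
  have tr1 : complex.Re (\tr (choi L)) = 1 by rewrite tr_choi.
  have psdc : psd (choi L) by apply: cp; exact: psd_rank1.
  split; first by move=> i j k; rewrite /K krausE //; exact: cvg_kraus_formula.
  split; first by move=> i j; exact: kraus_orthogonal.
  split; first exact: kraus_completeness.
  split.
    (* The sum of the K_i K_i^* is the image of the identity. *)
    move=> h; apply: nu; rewrite /unital -[RHS]h /L /kraus_map.
    by apply: eq_bigr => k _; rewrite mulmx1.
  do 4!split => //.
  split; first by apply: canonical_neg_scalar corr; lra.
  split; first exact: rank_choi_kraus.
  exact: correlation_useful_UQT tr1 t3 corr.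
Qed.
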